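(* Let $L$ be a $\mathrm{gl}$-regular Nijenhuis operator in a neighbourhood of a point $\mathsf p$ of an $n$-dimensional manifold. Then: 1. Every conservation law $\mathrm{d}f$ of $L$ is a conservation law for all of its symmetries, that is, $\mathrm{d}(M^*\mathrm{d}f)=0$ for any symmetry $M$ of $L$. 2. The regular hierarchies of conservation laws $\mathrm{d}f_1,\dots,\mathrm{d}f_n$ of $L$ are in one-to-one correspondence with the second companion coordinates centred at $\mathsf p$, in the sense that the 1-forms $\mathrm{d}f_1,\dots,\mathrm{d}f_n$ form a regular hierarchy (near $\mathsf p$) if and only if the functions $f_i-f_i(\mathsf p)$, $i=1,\dots,n$, are second companion coordinates centred at $\mathsf p$. In particular, the existence of regular hierarchies is equivalent to the reducibility of $L$ to the second companion form.
   Context: An operator field is a field of endomorphisms of the tangent bundle. All objects are smooth (the statement holds equally with everything real analytic), and all statements are local. For a 1-form $\alpha$, $(L^*\alpha)(\xi)=\alpha(L\xi)$. Nijenhuis operator: an operator field $L$ with $L^2[\xi,\eta]-L[L\xi,\eta]-L[\xi,L\eta]+[L\xi,L\eta]=0$ for all vector fields $\xi,\eta$. $\mathrm{gl}$-regular: at each point $L$ admits a cyclic vector, i.e. a tangent vector $\xi$ with $\xi,L\xi,\dots,L^{n-1}\xi$ linearly independent. Symmetry: for commuting operator fields $L,M$ put $\langle L,M\rangle(\xi,\eta)=M[L\xi,\eta]+L[\xi,M\eta]-[L\xi,M\eta]-LM[\xi,\eta]$; $M$ is a symmetry of $L$ if $LM=ML$ and $\langle L,M\rangle(\xi,\xi)=0$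 for all vector fields $\xi$. Conservation law of $L$: a closed 1-form $\mathrm{d}f$ such that $\mathrm{d}(L^*\mathrm{d}f)=0$. (For a Nijenhuis operator $L$, all forms $(L^* )^k\mathrm{d}f$ are then closed.) A hierarchy of conservation laws of $L$ is a sequence $\mathrm{d}f_1,\dots,\mathrm{d}f_n$, with $\mathrm{d}f_1$ a conservation law and $L^*\mathrm{d}f_i=\mathrm{d}f_{i+1}$ for $i=1,\dots,n-1$. A conservation law $\mathrm{d}f$ is regular if the 1-forms $(L^* )^i\mathrm{d}f$, $i=0,\dots,n-1$, are linearly independent; the corresponding hierarchy is then called regular. Second companion form: let $\det(\lambda\,\mathrm{Id}-L)=\lambda^n-\sigma_1\lambda^{n-1}-\dots-\sigma_n$. Local coordinates $x^1,\dots,x^n$ are second companion coordinates for $L$ if in them the matrix of $L$ is $$L_{\mathsf{comp2}}=\begin{pmatrix}0&1&0&\dots&0\\0&0&1&\dots&0\\\vdots&&&\ddots&\\0&0&0&\dots&1\\\sigma_n&\sigma_{n-1}&\sigma_{n-2}&\dots&\sigma_1\end{pmatrix}.$$ They are centred at $\mathsf p$ if they all vanish at $\mathsf p$. $L$ is reducible to the second companion form (near $\mathsf p$) if such coordinates exist near $\mathsf p$. *)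

(* Defs.v *)
From HB Require Import structures.
From mathcomp Require Import all_boot all_order all_algebra.
From mathcomp Require Import all_classical all_reals all_analysis.

Set Implicit Arguments.
Unset Strict Implicit.
Unset Printing Implicit Defensive.

Import Order.TTheory GRing.Theory Num.Theory.
Import numFieldNormedType.Exports.

Local Open Scope classical_set_scope.
Local Open Scope ring_scope.

(* Everything is local, so the manifold is an open subset of R^n in an
   auxiliary chart.  Points and tangent vectors are columns, 1-forms are rows,
   and an operator field is a matrix field acting on tangent vectors by
   xi |-> L *m xi and hence on 1-forms by alpha |-> alpha *m L.  All fields are
   total functions; only their values on the open set under consideration
   matter. *)

Section SmoothCalculus.
Context {R : realType} {n : nat}.
Local Notation E := 'cV[R]_n.

Definition partial {W : normedModType R} (i : 'I_n) (f : E -> W) : E -> W :=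
  'D_(delta_mx i 0) f.

(* The partial derivatives of order at most k exist and are continuous on the
   open set A. *)
Fixpoint Ck_on {W : normedModType R} (k : nat) (A : set E) (f : E -> W) : Prop :=
  match k with
  | 0 => forall x, A x -> {for x, continuous f}
  | k'.+1 => (forall x, A x -> {for x, continuous f}) /\
      forall i : 'I_n, (forall x, A x -> derivable f x (delta_mx i 0)) /\
                       Ck_on k' A (partial i f)
  end.

Definition smooth_on {W : normedModType R} (A : set E) (f : E -> W) : Prop :=
  forall k, Ck_on k A f.

Definition lie_bracket (xi eta : E -> E) : E -> E :=
  fun x => 'D_(xi x) eta x - 'D_(eta x) xi x.

Definition differential (f : E -> R) : E -> 'rV[R]_n :=
  fun x => \row_j partial j f x.

(* (d alpha)(e_i, e_j) *)
Definition ext_deriv (alpha : E -> 'rV[R]_n) : E -> 'M[R]_n :=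
  fun x => \matrix_(i, j) (partial i (fun y => alpha y 0 j) x
                           - partial j (fun y => alpha y 0 i) x).

Definition closed_form_on (A : set E) (alpha : E -> 'rV[R]_n) : Prop :=
  forall x, A x -> ext_deriv alpha x = 0.

Definition joint_map (u : 'I_n -> E -> R) : E -> E := fun x => \col_i u i x.

Definition jacobian_matrix (u : 'I_n -> E -> R) : E -> 'M[R]_n :=
  fun x => \matrix_(i, j) partial j (u i) x.

Definition coordinates_on (A : set E) (u : 'I_n -> E -> R) : Prop :=
  [/\ smooth_on A (joint_map u),
      open (joint_map u @` A) &
      exists2 v : E -> E, smooth_on (joint_map u @` A) v &
        forall x, A x -> v (joint_map u x) = x].

End SmoothCalculus.

Section OperatorFields.
Context {R : realType} {n : nat}.
Local Notation E := 'cV[R]_n.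
Implicit Types (A : set E) (L M : E -> 'M[R]_n).

Definition op_apply L (xi : E -> E) : E -> E := fun x => L x *m xi x.

Definition op_pullback L (alpha : E -> 'rV[R]_n) : E -> 'rV[R]_n :=
  fun x => alpha x *m L x.

Definition nijenhuis_on A L : Prop :=
  forall xi eta : E -> E, smooth_on A xi -> smooth_on A eta ->
  forall x, A x ->
    op_apply L (op_apply L (lie_bracket xi eta)) x
    - op_apply L (lie_bracket (op_apply L xi) eta) x
    - op_apply L (lie_bracket xi (op_apply L eta)) x
    + lie_bracket (op_apply L xi) (op_apply L eta) x = 0.

Definition gl_regular_on A L : Prop :=
  forall x, A x -> exists xi : 'cV[R]_n, free (mkseq (fun k => L x ^+ k *m xi) n).

Definition sym_bracket L M (xi eta : E -> E) : E -> E := fun x =>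
  op_apply M (lie_bracket (op_apply L xi) eta) x
  + op_apply L (lie_bracket xi (op_apply M eta)) x
  - lie_bracket (op_apply L xi) (op_apply M eta) x
  - op_apply L (op_apply M (lie_bracket xi eta)) x.

Definition symmetry_on A L M : Prop :=
  [/\ smooth_on A M,
      forall x, A x -> L x *m M x = M x *m L x &
      forall xi : E -> E, smooth_on A xi ->
        forall x, A x -> sym_bracket L M xi xi x = 0].

Definition conservation_law_on A L (f : E -> R) : Prop :=
  smooth_on A f /\ closed_form_on A (op_pullback L (differential f)).

Definition regular_form_on A L (f : E -> R) : Prop :=
  forall x, A x -> free (mkseq (fun k => differential f x *m L x ^+ k) n).

(* The functions f_1, ..., f_n are numbered from 0. *)
Definition hierarchy_on A L (f : 'I_n -> E -> R) : Prop :=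
  [/\ forall i, smooth_on A (f i),
      forall i : 'I_n, i = 0%N :> nat -> conservation_law_on A L (f i) &
      forall i j : 'I_n, j = i.+1 :> nat ->
        forall x, A x ->
          op_pullback L (differential (f i)) x = differential (f j) x].

Definition regular_hierarchy_on A L (f : 'I_n -> E -> R) : Prop :=
  hierarchy_on A L f /\
  forall i : 'I_n, i = 0%N :> nat -> regular_form_on A L (f i).

(* char_poly B = 'X^n - sigma_1 'X^(n-1) - ... - sigma_n *)
Definition sigma (B : 'M[R]_n) (k : nat) : R := - (char_poly B)`_(n - k).

Definition comp2 (B : 'M[R]_n) : 'M[R]_n :=
  \matrix_(i, j) if i.+1 == n then sigma B (n - j) else (j == i.+1 :> nat)%:R.

Definition matrix_in_coordinates L (u : 'I_n -> E -> R) : E -> 'M[R]_n :=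
  fun x => jacobian_matrix u x *m L x *m invmx (jacobian_matrix u x).

Definition second_companion_coordinates_on A L (u : 'I_n -> E -> R) : Prop :=
  coordinates_on A u /\
  forall x, A x -> matrix_in_coordinates L u x = comp2 (L x).

Definition centred_at (p : E) (u : 'I_n -> E -> R) : Prop :=
  forall i, u i p = 0.

(* In the next three definitions L is defined on U, and "near p" means on some
   open neighbourhood of p inside U. *)
Definition regular_hierarchy_near (U : set E) (p : E) L (f : 'I_n -> E -> R) :
    Prop :=
  exists V : set E, [/\ open_nbhs p V, V `<=` U & regular_hierarchy_on V L f].

Definition second_companion_coordinates_near (U : set E) (p : E) L
    (u : 'I_n -> E -> R) : Prop :=
  exists V : set E,
    [/\ open_nbhs p V, V `<=` U & second_companion_coordinates_on V L u].

Definition reducible_to_comp2_near (U : set E) (p : E) L : Prop :=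
  exists u : 'I_n -> E -> R, second_companion_coordinates_near U p L u.

End OperatorFields.

(* Main.v *)
(* Part 1. Put [B = d(M^* df)].  The conservation law for [L], the derivative of
   [LM = ML] and the polarized identity [<L, M>(a, b) + <L, M>(b, a) = 0], all
   evaluated on constant vector fields, combine to [B(La, b) = B(a, Lb)].  For a
   cyclic vector [w] the number [B(L^i w, L^j w) = B(w, L^(i+j) w)] is then both
   symmetric and skew in the two arguments, hence zero, and [B = 0].

   Part 2. With [J] the Jacobian matrix of [f_1, ..., f_n], the equations
   [L^* df_i = df_(i+1)] are the first rows of [J L = comp2(L) J], and the last row
   is then the Cayley-Hamilton theorem.  Regularity of the hierarchy says that [J]
   is invertible, so the smooth inverse function theorem turns the [f_i] into
   coordinates. *)

Require Import Defs.
From HB Require Import structures.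
From mathcomp Require Import all_boot all_order all_algebra perm.
From mathcomp Require Import all_classical all_reals all_analysis.
From mathcomp Require Import ring lra.
Import Order.TTheory GRing.Theory Num.Theory.
Import numFieldNormedType.Exports.
Local Open Scope classical_set_scope.
Local Open Scope ring_scope.

Set Implicit Arguments.
Unset Strict Implicit.
Unset Printing Implicit Defensive.

(** * Functions of class C^k *)

Section CkCalculus.
Context {R : realType} {n : nat}.
Local Notation E := 'cV[R]_n.
Implicit Types (A B : set E) (k : nat).

(** [Ck_on] speaks only of iterated partial derivatives, so total differentiability, the chain rule,
    the symmetry of second derivatives and the inverse function theorem are all derived from
    partials. The bridge is the sup norm: its balls are boxes, in which the partials alone control
    increments. The resulting estimate is kept in a two-point, strict form, because that form turns
    the inverse function theorem into a contraction argument and also propagates invertibility of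
    the Jacobian from [p] to a whole neighbourhood. Constant vector fields suffice for the first
    part because the value of a 2-form at a point depends only on the vectors there. Every identity
    thus becomes matrix algebra at one point, in the Hessian of [f] and the first derivatives of [L]
    and [M]. As <L, M> vanishes only on the diagonal, just its symmetrization in (a, b) is
    available, and the combination giving self-adjointness of [L] must respect that. *)

Lemma Ck_on_sub (W : normedModType R) k A B (f : E -> W) :
  B `<=` A -> Ck_on k A f -> Ck_on k B f.
Proof.
move=> BA; elim: k f => [f cf x /BA/cf //|k IH f [cf df]].
split=> [x /BA/cf //|i]; have [dfi Cfi] := df i.
by split=> [x /BA/dfi //|]; exact: IH.
Qed.

Lemma Ck_onW (W : normedModType R) k A (f : E -> W) : Ck_on k.+1 A f -> Ck_on k A f.
Proof.
elim: k f => [f []//|k IH f [cf df]]; split=> // i.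
by have [dfi Cfi] := df i; split=> //; exact: IH.
Qed.

Lemma open_near A x : open A -> A x -> \forall y \near x, A y.
Proof. by move=> oA Ax; apply: open_nbhs_nbhs. Qed.

Lemma eq_on_near (W : Type) A (f g : E -> W) x : open A -> A x ->
  (forall y, A y -> f y = g y) -> {near x, f =1 g}.
Proof. by move=> oA Ax fg; apply: filterS (open_near oA Ax) => y /fg. Qed.

Lemma eq_on_partial (W : normedModType R) A (f g : E -> W) i : open A ->
  (forall y, A y -> f y = g y) -> forall y, A y -> partial i f y = partial i g y.
Proof.
move=> oA fg y Ay; exact/near_eq_derive/(eq_on_near oA Ay fg).
Qed.

(** Fields are total functions whose values matter only on [A], and the rules computing a partial
    derivative hold only there. Openness of [A] makes agreement on [A] enough, since continuity and
    derivatives depend on germs. *)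
Lemma eq_Ck_on (W : normedModType R) k A (f g : E -> W) : open A ->
  (forall x, A x -> f x = g x) -> Ck_on k A f -> Ck_on k A g.
Proof.
move=> oA; elim: k f g => [|k IH] f g fg /=; have cg x : A x ->
    {for x, continuous f} -> {for x, continuous g}.
- move=> Ax; rewrite /prop_for /continuous_at -(fg _ Ax).
  by move=> cf; apply: cvg_trans cf; exact: near_eq_cvg (eq_on_near oA Ax fg).
- by move=> cf x Ax; apply: cg => //; exact: cf.
- move=> Ax; rewrite /prop_for /continuous_at -(fg _ Ax).
  by move=> cf; apply: cvg_trans cf; exact: near_eq_cvg (eq_on_near oA Ax fg).
- move=> [cf df]; split=> [x Ax|i]; first by apply: cg => //; exact: cf.
  have [dfi Cfi] := df i; split=> [x Ax|].
    apply: near_eq_derivable (dfi x Ax); exact: (eq_on_near oA Ax fg).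
  by apply: IH Cfi; exact: (eq_on_partial i oA fg).
Qed.

Lemma Ck_on_cst (W : normedModType R) k A (c : W) : Ck_on k A (cst c : E -> W).
Proof.
elim: k c => [c x _|k IH c]; first exact: cst_continuous.
split=> [x _|i]; first exact: cst_continuous.
split=> [x _|]; first exact: derivable_cst.
rewrite (_ : partial i _ = cst 0); first exact: IH.
by apply/funext => x; rewrite /partial derive_cst.
Qed.

Lemma Ck_onD (W : normedModType R) k A (f g : E -> W) : open A ->
  Ck_on k A f -> Ck_on k A g -> Ck_on k A (f + g).
Proof.
move=> oA; elim: k f g => [|k IH] f g /=.
  by move=> cf cg x Ax; apply: continuousD; [exact: cf|exact: cg].
move=> [cf df] [cg dg]; split=> [x Ax|i].
  by apply: continuousD; [exact: cf|exact: cg].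
have [dfi Cfi] := df i; have [dgi Cgi] := dg i; split=> [x Ax|].
  by apply: derivableD; [exact: dfi|exact: dgi].
apply: (eq_Ck_on oA) (IH _ _ Cfi Cgi) => x Ax.
by rewrite /partial deriveD; [|exact: dfi|exact: dgi].
Qed.

Lemma Ck_onM k A (f g : E -> R) : open A ->
  Ck_on k A f -> Ck_on k A g -> Ck_on k A (f * g).
Proof.
move=> oA; elim: k f g => [|k IH] f g.
  by move=> cf cg x Ax; apply: continuousM; [exact: cf|exact: cg].
move=> Cf Cg; have [cf df] := Cf; have [cg dg] := Cg; split=> [x Ax|i].
  by apply: continuousM; [exact: cf|exact: cg].
have [dfi Cfi] := df i; have [dgi Cgi] := dg i; split=> [x Ax|].
  by apply: derivableM; [exact: dfi|exact: dgi].
have C := Ck_onD oA (IH _ _ (Ck_onW Cf) Cgi) (IH _ _ (Ck_onW Cg) Cfi).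
apply: (eq_Ck_on oA) C => x Ax.
by rewrite /partial deriveM; [|exact: dfi|exact: dgi].
Qed.

Lemma Ck_onV k A (f : E -> R) : open A -> (forall x, A x -> f x != 0) ->
  Ck_on k A f -> Ck_on k A (fun x => (f x)^-1).
Proof.
move=> oA f0; elim: k => [|k IH].
  by move=> cf x Ax; apply: continuousV; [exact: f0|exact: cf].
move=> Cf; have [cf df] := Cf; split=> [x Ax|i].
  by apply: continuousV; [exact: f0|exact: cf].
have [dfi Cfi] := df i; split=> [x Ax|].
  by apply: derivableV; [exact: f0|exact: dfi].
have CV := IH (Ck_onW Cf).
have C := Ck_onM oA (Ck_onM oA (Ck_onM oA CV CV) (Ck_on_cst k A (-1 : R))) Cfi.
apply: (eq_Ck_on oA) C => x Ax.
rewrite /partial (deriveV (f0 _ Ax) (dfi x Ax)) /= -exprVn.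
by rewrite /GRing.scale/= -[LHS]/((((f x)^-1 * (f x)^-1) * -1) * _) mulrN1.
Qed.

Lemma Ck_on_sum k A (W : normedModType R) I (r : seq I) (P : pred I)
    (f : I -> E -> W) : open A ->
  (forall i, P i -> Ck_on k A (f i)) -> Ck_on k A (fun x => \sum_(i <- r | P i) f i x).
Proof.
move=> oA Cf.
suff: Ck_on k A (\sum_(i <- r | P i) f i) by rewrite fct_sumE.
by elim/big_ind: _ => //; [exact: Ck_on_cst|move=> g h; exact: Ck_onD].
Qed.

Lemma Ck_on_prod k A I (r : seq I) (P : pred I) (f : I -> E -> R) : open A ->
  (forall i, P i -> Ck_on k A (f i)) ->
  Ck_on k A (fun x => \prod_(i <- r | P i) f i x).
Proof.
move=> oA Cf; elim: r => [|i r IH].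
  rewrite (_ : (fun _ => _) = cst 1); first exact: Ck_on_cst.
  by apply/funext => x; rewrite big_nil.
case: (boolP (P i)) => Pi; last first.
  by rewrite (_ : (fun _ => _) = (fun x => \prod_(i <- r | P i) f i x)) //;
    apply/funext => x; rewrite big_cons (negbTE Pi).
rewrite (_ : (fun _ => _) = f i * (fun x => \prod_(i <- r | P i) f i x)).
  by apply: Ck_onM => //; exact: Cf.
by apply/funext => x; rewrite big_cons Pi.
Qed.

Lemma continuous_mxP (T : topologicalType) m q (F : T -> 'M[R]_(m, q)) x :
  {for x, continuous F} <-> forall i j, {for x, continuous (fun y => F y i j)}.
Proof.
split=> [cF i j|cF].
  exact: (@continuous_comp _ _ _ F (fun M : 'M[R]_(m, q) => M i j) _ cF
    (@coord_continuous _ _ _ i j _)).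
apply/cvgrPdist_le => /= e e0; near=> y.
rewrite /Num.Def.normr/= mx_normrE (bigmax_le _ (ltW e0))//= => i _.
rewrite !mxE/=.
move: i; near: y; apply: filter_forall => /= i.
exact: ((cvgrPdist_le _ _).1 (cF i.1 i.2)).
Unshelve. all: by end_near. Qed.

Lemma partial_mx m q i (F : E -> 'M[R]_(m, q)) x a b :
  derivable F x (delta_mx i 0) ->
  partial i F x a b = partial i (fun y => F y a b) x.
Proof. by move=> dF; rewrite /partial derive_mx // mxE. Qed.

Lemma Ck_on_mxP k A m q (F : E -> 'M[R]_(m, q)) : open A ->
  Ck_on k A F <-> forall i j, Ck_on k A (fun x => F x i j).
Proof.
move=> oA; elim: k F => [|k IH] F.
  split=> [cF i j x Ax|cF x Ax]; first exact: (continuous_mxP _ _).1 (cF x Ax) i j.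
  by apply/continuous_mxP => i j; exact: cF.
split=> [[cF dF] a b|CF].
  split=> [x Ax|i]; first exact: (continuous_mxP _ _).1 (cF x Ax) a b.
  have [dFi CFi] := dF i; split=> [x Ax|].
    by have /derivable_mxP := dFi x Ax; exact.
  apply: (eq_Ck_on oA) ((IH _).1 CFi a b) => x Ax.
  exact/partial_mx/dFi.
have dF i x : A x -> derivable F x (delta_mx i 0).
  by move=> Ax; apply/derivable_mxP => a b; have [_ /(_ i)[+ _]] := CF a b; exact.
split=> [x Ax|i]; first by apply/continuous_mxP => a b; have [+ _] := CF a b; exact.
split=> [x Ax|]; first exact: dF.
apply/IH => a b; have [_ /(_ i)[_ C]] := CF a b.
by apply: (eq_Ck_on oA) C => x Ax; rewrite partial_mx //; exact: dF.
Qed.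

Lemma Ck_on_det k A m (F : E -> 'M[R]_m) : open A ->
  (forall i j, Ck_on k A (fun x => F x i j)) -> Ck_on k A (fun x => \det (F x)).
Proof.
move=> oA CF; apply: Ck_on_sum => // s _.
have Cp : Ck_on k A (fun x => \prod_i F x i (s i)).
  by apply: Ck_on_prod => // i _; exact: CF.
exact: (Ck_onM oA (Ck_on_cst k A ((-1) ^+ s : R)) Cp).
Qed.

(** Cramer's rule: each entry of the inverse is a cofactor divided by the determinant. *)
Lemma Ck_on_invmx k A m (F : E -> 'M[R]_m) : open A ->
  (forall x, A x -> F x \in unitmx) ->
  (forall i j, Ck_on k A (fun x => F x i j)) ->
  forall i j, Ck_on k A (fun x => invmx (F x) i j).
Proof.
move=> oA uF CF i j.
have Cadj : Ck_on k A (fun x => cofactor (F x) j i).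
  suff Cd : Ck_on k A (fun x => \det (row' j (col' i (F x)))).
    exact: (Ck_onM oA (Ck_on_cst k A ((-1) ^+ (j + i) : R)) Cd).
  apply: Ck_on_det => // a b.
  by apply: (eq_Ck_on oA) (CF (lift j a) (lift i b)) => x _; rewrite !mxE.
have dF0 x : A x -> \det (F x) != 0 by move/uF; rewrite unitmxE unitfE.
have CdV := Ck_onV oA dF0 (Ck_on_det oA CF).
apply: (eq_Ck_on oA) (Ck_onM oA CdV Cadj) => x Ax.
by rewrite /invmx uF // !mxE.
Qed.

End CkCalculus.

(** * Increments and differentiability *)

Section Increments.
Context {R : realType} {n : nat}.
Local Notation E := 'cV[R]_n.
Implicit Types (A : set E) (x y v : E).

Lemma coord_le_norm m q (M : 'M[R]_(m, q)) i j : `|M i j| <= `|M|.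
Proof.
by rewrite [leRHS]/Num.Def.normr/= mx_normrE; exact: (le_bigmax _ _ (i, j)).
Qed.

Lemma norm_mx_le m q (M : 'M[R]_(m, q)) (r : R) : 0 <= r ->
  (forall i j, `|M i j| <= r) -> `|M| <= r.
Proof.
by move=> r0 Mr; rewrite [leLHS]/Num.Def.normr/= mx_normrE (bigmax_le _ r0).
Qed.

Lemma ball_cVP x (r : R) y :
  ball x r y <-> 0 < r /\ forall i, `|x i 0 - y i 0| < r.
Proof.
split=> [[r0 xy]|[r0 xy]]; split=> // i; first exact: xy.
by move=> j; rewrite ord1; exact: xy.
Qed.

Lemma is_derive_line (W : normedModType R) (f : E -> W) x v (t : R) :
  derivable f (x + t *: v) v ->
  is_derive t (1 : R) (fun s => f (x + s *: v)) ('D_v f (x + t *: v)).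
Proof.
have eqg : (fun h : R => h^-1 *: (((fun s => f (x + s *: v)) \o shift t) (h *: (1 : R))
      - f (x + t *: v)))
    = (fun h : R => h^-1 *: ((f \o shift (x + t *: v)) (h *: v) - f (x + t *: v))).
  apply/funext => h /=; congr (_ *: (f _ - _)).
  by rewrite [h *: 1]mulr1 scalerDl addrCA.
by move=> df; split; rewrite /derivable /derive eqg.
Qed.

(** The segment is parametrized by [0, 1] and scaled by [s], so that [s] may have either sign, as
    coordinate increments do. *)
Lemma MVT_line (f : E -> R) x v (s : R) :
  (forall t : R, 0 <= t <= 1 -> derivable f (x + (s * t) *: v) v) ->
  exists2 t : R, 0 <= t <= 1 &
    f (x + s *: v) - f x = s * 'D_v f (x + (s * t) *: v).
Proof.
move=> df; pose g (t : R) := f (x + (s * t) *: v).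
have dg (t : R) : 0 <= t <= 1 -> is_derive t (1 : R) g ('D_v f (x + (s * t) *: v) * s).
  move=> t01; have d1 := is_derive_line (df _ t01).
  have d2 : is_derive t (1 : R) (s \*: (@id R)) s.
    by rewrite -[X in is_derive _ _ _ X]mulr1; exact: is_deriveZ.
  exact: is_derive1_comp d1 d2.
have [t||t t01] := @MVT_segment R g (fun t => 'D_v f (x + (s * t) *: v) * s) 0 1 ler01.
- by rewrite in_itv/= => /andP[t0 t1]; apply: dg; rewrite !ltW.
- apply: derivable_within_continuous => t; rewrite in_itv/= => t01.
  by have [] := dg t t01.
rewrite /g mulr1 mulr0 scale0r addr0 subr0 mulr1 mulrC => fE.
by exists t => //; move: t01; rewrite in_itv.
Qed.

(* A sup-norm ball is a box, so one can walk from [x] to [y] changing one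
   coordinate at a time without leaving it; partial derivatives suffice. *)
Lemma increment_le (f : E -> R) (c : 'I_n -> R) (eps r : R) p :
  (forall z i, ball p r z ->
    derivable f z (delta_mx i 0) /\ `|partial i f z - c i| <= eps) ->
  forall x y, ball p r x -> ball p r y ->
  `|f y - f x - \sum_i c i * (y i 0 - x i 0)| <= n%:R * eps * `|y - x|.
Proof.
move=> df x y /ball_cVP[r0 px] /ball_cVP[_ py].
pose z k : E := \col_i (if (i < k)%N then y i 0 else x i 0).
have zn : z n = y by apply/colP => i; rewrite mxE ltn_ord.
suff step k : (k <= n)%N ->
    `|f (z k) - f x - \sum_(i < n | (i < k)%N) c i * (y i 0 - x i 0)|
      <= k%:R * eps * `|y - x|.
  have := step n (leqnn n); rewrite zn; congr (`|_ - _| <= _).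
  by apply: eq_bigl => i; rewrite ltn_ord.
elim: k => [_|k IH kn].
  rewrite big_pred0 // (_ : z 0%N = x) ?subrr ?subr0 ?normr0 ?mul0r //.
  by apply/colP => i; rewrite mxE.
pose i := Ordinal kn; pose s := y i 0 - x i 0.
have zS : z k.+1 = z k + s *: delta_mx i 0.
  apply/colP => j; rewrite !mxE eqxx andbT ltnS leq_eqVlt.
  have [->|/negbTE ji] := eqVneq j i.
    by rewrite eqxx /= ltnn mulr1 addrC subrK.
  by rewrite -[(j == k :> nat)]/(j == i) ji /= mulr0 addr0.
(* The moving coordinate is a convex combination of those of [x] and [y], hence no farther from that
   of [p] than the worse of the two. *)
have pzt (t : R) : 0 <= t <= 1 -> ball p r (z k + (s * t) *: delta_mx i 0).
  move=> /andP[t0 t1]; apply/ball_cVP; split=> // j; rewrite !mxE eqxx andbT.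
  have [->|/negbTE ji] := eqVneq j i; last first.
    by rewrite mulr0 addr0; case: ifP.
  rewrite ltnn mulr1 /s.
  rewrite (_ : _ - _ = (1 - t) * (p i 0 - x i 0) + t * (p i 0 - y i 0)); last by ring.
  rewrite (le_lt_trans (ler_normD _ _)) // !normrM (ger0_norm t0).
  rewrite (@ger0_norm _ (1 - t)) ?subr_ge0 //.
  have := px i; have := py i.
  set a := `|p i 0 - y i 0|; set b := `|p i 0 - x i 0| => ar br.
  have [ab|/ltW ba] := leP a b.
    apply: le_lt_trans br; rewrite -subr_ge0 (_ : _ - _ = t * (b - a)); last by ring.
    by rewrite mulr_ge0 // subr_ge0.
  apply: le_lt_trans ar; rewrite -subr_ge0 (_ : _ - _ = (1 - t) * (a - b)); last first.
    by ring.
  by rewrite mulr_ge0 // subr_ge0.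
have [t t01 fE] := @MVT_line f (z k) (delta_mx i 0) s
  (fun t t01 => (df _ i (pzt t t01)).1).
have [_ dle] := df _ i (pzt t t01).
rewrite (bigD1 i) //= -/s.
rewrite (eq_bigl (fun j : 'I_n => (j < k)%N)); last first.
  by move=> j; rewrite ltnS ltn_neqAle andbC -(inj_eq val_inj).
rewrite zS; set S := \sum_(_ < _ | _) _.
set w := partial i f (z k + (s * t) *: delta_mx i 0) in dle.
rewrite (_ : _ - _ = s * (w - c i) + (f (z k) - f x - S)); last first.
  have : f (z k + s *: delta_mx i 0) - f (z k) = s * w by rewrite fE.
  by move=> /(canRL (subrK _)) ->; ring.
rewrite (_ : k.+1%:R * _ * _ = eps * `|y - x| + k%:R * eps * `|y - x|); last first.
  by rewrite -natr1; ring.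
apply: le_trans (ler_normD _ _) _; apply: lerD; last exact: IH (ltnW kn).
rewrite normrM mulrC; apply: ler_pM => //.
by have := coord_le_norm (y - x) i 0; rewrite !mxE.
Qed.

Lemma C1_partial A (f : E -> R) : Ck_on 1 A f -> forall x i, A x ->
  derivable f x (delta_mx i 0) /\ {for x, continuous (partial i f)}.
Proof.
by move=> [_ Cf] x i Ax; have [df cf] := Cf i; split; [exact: df|exact: cf].
Qed.

(** Near [x] the partials differ little from their values at [x], so [increment_le] applies with
    those values as slopes. Both points are free; fixing one of them at [x] gives Fréchet
    differentiability. *)
Lemma C1_strict_differentiable A (f : E -> R) x (eps : R) :
  open A -> Ck_on 1 A f -> A x -> 0 < eps ->
  \forall d \near 0^'+, forall y z, ball x d y -> ball x d z ->
    `|f y - f z - (differential f x *m (y - z)) 0 0| <= eps * `|y - z|.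
Proof.
(* The increment estimate loses a factor [n]; dividing by [n.+1] absorbs it and is safe when [n] is
   zero. *)
move=> oA Cf Ax e0; pose e1 := eps / n.+1%:R.
have e10 : 0 < e1 by rewrite divr_gt0.
have nf : \forall y \near x, forall i, `|partial i f x - partial i f y| <= e1.
  have nfi i : \forall y \near x, `|partial i f x - partial i f y| <= e1.
    by have [_ cf] := C1_partial Cf i Ax; exact: (cvgrPdist_le _ _).1 cf _ e10.
  exact: filter_forall nfi.
have /nbhs_ballP[r/= r0 xr] : nbhs x (A `&`
    [set y | forall i, `|partial i f x - partial i f y| <= e1]).
  exact: filterI (open_near oA Ax) nf.
near=> d => y z xy xz.
have dr : d <= r by near: d; exact: nbhs_right_le.
have H := @increment_le f (fun i => partial i f x) e1 r x.
have {H} := H _ z y (le_ball dr xz) (le_ball dr xy).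
rewrite (_ : (differential f x *m _) 0 0 =
  \sum_i partial i f x * (y i 0 - z i 0)); last first.
  by rewrite !mxE; apply: eq_bigr => i _; rewrite !mxE.
move=> H; apply: le_trans (H _) _.
  move=> u i xu; have [Au uP] := xr _ xu; rewrite distrC.
  by split; [exact: (C1_partial Cf _ Au).1|exact: uP].
apply: ler_wpM2r => //; rewrite /e1 mulrA ler_pdivrMr // mulrC ler_pM2l //.
by rewrite ler_nat.
Unshelve. all: by end_near. Qed.

Section LinearForm.
Variable a : 'rV[R]_n.

(** Named so that it can carry the structure of a linear map, the type in which differentials are
    compared. *)
Definition linear_form v : R := (a *m v) 0 0.

Lemma linear_form_is_linear : linear linear_form.
Proof. by move=> k v w; rewrite /linear_form mulmxDr -scalemxAr !mxE. Qed.

HB.instance Definition _ :=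
  GRing.isLinear.Build R E R _ linear_form linear_form_is_linear.

Lemma linear_form_continuous : continuous linear_form.
Proof.
move=> v.
have -> : linear_form = fun v => \sum_i (cst (a 0 i) * (fun u : E => u i 0)) v.
  by apply/funext => u; rewrite /linear_form mxE.
apply: (@Ck_on_sum R n 0 setT) => //; first exact: openT.
move=> i _ u _; apply: continuousM; first exact: cst_continuous.
exact: coord_continuous.
Qed.

End LinearForm.

Lemma C1_diff A (f : E -> R) x : open A -> Ck_on 1 A f -> A x ->
  differentiable f x /\ 'd f x = linear_form (differential f x) :> (E -> R).
Proof.
move=> oA Cf Ax.
have dfE (eps : R) : 0 < eps -> \forall h \near (0 : E),
    `|f (h + x) - (f x + linear_form (differential f x) h)| <= eps * `|h|.
  move=> e0.
  have nd := C1_strict_differentiable oA Cf Ax e0.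
  have [d [d0 H]] := filter_ex (filterI (nbhs_right_gt (0 : R)) nd).
  near=> h; have := H (h + x) x; rewrite addrK opprD addrA; apply; last exact: ballxx.
  rewrite -ball_normE /= opprD addrCA subrr addr0 normrN.
  near: h. exact: (@nbhs0_lt R E d d0).
have dE : 'd f x = linear_form (differential f x) :> (E -> R).
  apply: diff_unique; first exact: linear_form_continuous.
  by apply/eqaddoP => eps; exact: dfE.
split=> //; apply/diff_locallyP; rewrite dE; split; first exact: linear_form_continuous.
by apply/eqaddoP => eps; exact: dfE.
Unshelve. all: by end_near. Qed.

Lemma C1_derive A (f : E -> R) x v : open A -> Ck_on 1 A f -> A x ->
  derivable f x v /\ 'D_v f x = (differential f x *m v) 0 0.
Proof.
move=> oA Cf Ax; have [df dE] := C1_diff oA Cf Ax.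
by split; [exact: diff_derivable|rewrite deriveE // dE].
Qed.

End Increments.

(** * Chain rule and symmetry of second derivatives *)

Section ChainRule.
Context {R : realType} {n : nat}.
Local Notation E := 'cV[R]_n.
Implicit Types (A B : set E) (x y v w : E).

Lemma Ck_on1 (W : normedModType R) k A (f : E -> W) : Ck_on k.+1 A f -> Ck_on 1 A f.
Proof. by elim: k => // k IH /Ck_onW. Qed.

Lemma derive_comp_line (W : normedModType R) (f : E -> W) y w :
  'D_w f y = 'D_(1 : R) (fun h : R => f (h *: w + y)) 0.
Proof.
rewrite /derive; set g1 := fun h => h^-1 *: _; set g2 := fun h => h^-1 *: _.
suff -> : g1 = g2 by [].
by rewrite funeqE /g1 /g2 => h /=; rewrite addr0 scale0r add0r [_%:A]mulr1.
Qed.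

(** [phi] is only derivable along [w]. Restricted to the line through [y] it becomes differentiable
    in one real variable, and composing with the differentiable [G] is then the usual chain rule. *)
Lemma chain_rule A (G : E -> R) (phi : E -> E) y w :
  open A -> Ck_on 1 A G -> A (phi y) -> derivable phi y w ->
  derivable (G \o phi) y w /\
  'D_w (G \o phi) y = (differential G (phi y) *m 'D_w phi y) 0 0.
Proof.
move=> oA CG Ay /derivable1P /derivable1_diffP dphi.
set g := (fun h => _) in dphi.
have g0 : g 0 = phi y by rewrite /g scale0r add0r.
have Ag0 : A (g 0) by rewrite g0.
have [dG dGE] := C1_diff oA CG Ag0.
split; first exact/derivable1P/derivable1_diffP/(differentiable_comp dphi dG).
rewrite derive_comp_line -[fun h : R => _]/(G \o g).
rewrite deriveE; last exact: differentiable_comp dphi dG.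
rewrite (diff_comp dphi dG) dGE g0 derive_comp_line.
by congr ((_ *m _) 0 0); rewrite deriveE.
Qed.

(** The induction generalizes over [G], because the chain rule replaces [G] by its partial
    derivatives composed with the same [phi]. *)
Lemma Ck_on_comp k A B (phi : E -> E) (G : E -> R) : open A -> open B ->
  (forall y, B y -> A (phi y)) -> Ck_on k B phi -> Ck_on k A G ->
  Ck_on k B (G \o phi).
Proof.
move=> oA oB AB; elim: k G => [|k IH] G Cphi CG.
  by move=> y By; apply: continuous_comp; [exact: Cphi|exact/CG/AB].
have [cphi dphi] := Cphi; have [cG dG] := CG; split=> [y By|i].
  by apply: continuous_comp; [exact: cphi|exact/cG/AB].
have [dphii Cphii] := dphi i; split=> [y By|].
  by have [] := chain_rule oA (Ck_on1 CG) (AB _ By) (dphii _ By).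
have C : Ck_on k B
    (fun y => \sum_j ((partial j G \o phi) * (fun z => partial i phi z j 0)) y).
  apply: Ck_on_sum => // j _; apply: Ck_onM => //.
    by apply: IH; [exact: Ck_onW|have [_ ] := dG j].
  exact: (Ck_on_mxP _ _ oB).1 Cphii j 0.
apply: (eq_Ck_on oB) C => y By.
have [_ dE] := chain_rule oA (Ck_on1 CG) (AB _ By) (dphii _ By).
by rewrite [RHS]dE mxE; apply: eq_bigr => j _; rewrite mxE.
Qed.

Lemma derivable_shift (W : normedModType R) (f : E -> W) x v c :
  derivable f (x + c) v -> derivable (fun y => f (y + c)) x v.
Proof.
rewrite /derivable; set g1 := fun h => h^-1 *: _; set g2 := fun h => h^-1 *: _.
suff -> : g1 = g2 by [].
by rewrite funeqE /g1 /g2 => h /=; rewrite addrA.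
Qed.

Lemma derive_shiftE (W : normedModType R) (f : E -> W) x v c :
  'D_v (fun y => f (y + c)) x = 'D_v f (x + c).
Proof.
rewrite /derive; set g1 := fun h => h^-1 *: _; set g2 := fun h => h^-1 *: _.
suff -> : g1 = g2 by [].
by rewrite funeqE /g1 /g2 => h /=; rewrite addrA.
Qed.

Lemma norm_delta_le (i : 'I_n) (s : R) : `|s *: (delta_mx i 0 : E)| <= `|s|.
Proof.
apply: norm_mx_le => // a b; rewrite !mxE normrM ler_piMr //.
by case: (_ && _); rewrite ?normr1 // normr0.
Qed.

(** The mean value theorem is used twice: along [ei] for the difference of [f] and its translate by
    [s *: ej], then along [ej] for [partial i f]. Two steps of length [s] stay in the ball because
    [s + s < r]. *)
Lemma second_difference (f : E -> R) x (i j : 'I_n) (s r : R) : 0 <= s -> s + s < r ->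
  (forall z, ball x r z -> derivable f z (delta_mx i 0) /\
     derivable (partial i f) z (delta_mx j 0)) ->
  exists2 z, ball x r z &
    f (x + s *: delta_mx i 0 + s *: delta_mx j 0) - f (x + s *: delta_mx i 0)
      - f (x + s *: delta_mx j 0) + f x = s * s * partial j (partial i f) z.
Proof.
move=> s0 sr df; set ei : E := delta_mx i 0; set ej : E := delta_mx j 0.
have st t : 0 <= t <= 1 -> `|s * t| <= s.
  by move=> /andP[t0 t1]; rewrite ger0_norm ?mulr_ge0 // ler_piMr.
have xb (a b : R) : `|a| <= s -> `|b| <= s -> ball x r (x + a *: ei + b *: ej).
  move=> sa sb; rewrite -ball_normE /= -addrA opprD addrA subrr sub0r normrN.
  apply: le_lt_trans sr; apply: le_trans (ler_normD _ _) _.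
  by apply: lerD; apply: le_trans (norm_delta_le _ _) _.
have ss : `|s| <= s by rewrite ger0_norm.
have n0 : `|0 : R| <= s by rewrite normr0.
pose g := (fun y => f (y + s *: ej)) - f.
have dg t : 0 <= t <= 1 -> derivable (fun y => f (y + s *: ej)) (x + (s * t) *: ei) ei.
  by move=> t01; apply: derivable_shift; have [] := df _ (xb _ _ (st t t01) ss).
have df0 t : 0 <= t <= 1 -> derivable f (x + (s * t) *: ei) ei.
  move=> t01; have [+ _] := df _ (xb _ _ (st t t01) n0).
  by rewrite scale0r addr0.
have [t t01 gE] := @MVT_line R n g x ei s
  (fun t t01 => derivableB (dg t t01) (df0 t t01)).
have [u u01 hE] := @MVT_line R n (partial i f) (x + (s * t) *: ei) ej s
  (fun u u01 => (df _ (xb _ _ (st t t01) (st u u01))).2).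
exists (x + (s * t) *: ei + (s * u) *: ej); first exact: xb (st t t01) (st u u01).
rewrite -mulrA -[partial j _ _]/('D_ej (partial i f) _) -hE.
rewrite [partial i f _ - _](_ : _ = 'D_ei g (x + (s * t) *: ei)).
  have gD y : g y = f (y + s *: ej) - f y by [].
  have rearrange (a b c d : R) : a - b - c + d = a - b - (c - d) by ring.
  by rewrite -gE !gD; exact: rearrange.
by rewrite deriveB ?derive_shiftE //; [exact: dg|exact: df0].
Qed.

(** The second difference is symmetric in [i] and [j], so the two mixed partials take a common value
    at two points close to [x]; continuity brings both to [x]. The step [r / 3] leaves room for two
    moves inside the ball of radius [r]. *)
Lemma partialC A (f : E -> R) x (i j : 'I_n) : open A -> Ck_on 2 A f -> A x ->
  partial j (partial i f) x = partial i (partial j f) x.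
Proof.
move=> oA Cf Ax.
have [_ df] := Cf.
have d1 a y : A y -> derivable f y (delta_mx a 0).
  by move=> Ay; have [+ _] := df a; exact.
have d2 a b y : A y -> derivable (partial a f) y (delta_mx b 0).
  by move=> Ay; have [_ Ca] := df a; have [] := C1_partial Ca b Ay.
have c2 a b : {for x, continuous (partial b (partial a f))}.
  by have [_ Ca] := df a; have [] := C1_partial Ca b Ax.
pose Delta s a b := f (x + s *: delta_mx a 0 + s *: delta_mx b 0)
  - f (x + s *: delta_mx a 0) - f (x + s *: delta_mx b 0) + f x.
have DeltaC s : Delta s i j = Delta s j i.
  have rearrange (a b c d : R) : a - b - c + d = a - c - b + d by ring.
  by rewrite /Delta (addrAC x (s *: delta_mx j 0)); exact: rearrange.
have dDelta a b r : 0 < r -> ball x r `<=` A ->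
    exists2 z, ball x r z &
      Delta (r / 3) a b = r / 3 * (r / 3) * partial b (partial a f) z.
  move=> r0 xr; apply: second_difference; [lra|lra|].
  by move=> z /xr Az; split; [exact: d1|exact: d2].
move: (c2 i j) (c2 j i) (dDelta i j) (dDelta j i).
generalize (partial j (partial i f)) (partial i (partial j f)) => D1 D2 cD1 cD2 dD1 dD2.
apply/eqP; rewrite -subr_eq0 -normr_le0; apply/ler_addgt0Pr => e e0; rewrite add0r.
have e20 : 0 < e / 2 by rewrite divr_gt0.
have /nbhs_ballP[r/= r0 xr] : nbhs x (A `&` ([set y | `|D1 x - D1 y| <= e / 2] `&`
    [set y | `|D2 x - D2 y| <= e / 2])).
  apply: filterI; first exact: open_near.
  by apply: filterI; [exact: (cvgrPdist_le _ _).1 cD1 _ e20|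
    exact: (cvgrPdist_le _ _).1 cD2 _ e20].
have xrA : ball x r `<=` A by move=> z /xr[].
have [z xz zE] := dD1 r r0 xrA; have [y xy yE] := dD2 r r0 xrA.
have [_ [zP _]] := xr _ xz; have [_ [_ yP]] := xr _ xy.
have zy : D1 z = D2 y.
  apply: (@mulfI _ (r / 3 * (r / 3))); first by rewrite gt_eqF // mulr_gt0 // divr_gt0.
  by rewrite -zE DeltaC yE.
rewrite -[X in `|X|](subrKA (D2 y)) (splitr e).
apply: le_trans (ler_normD _ _) _; apply: lerD; first by rewrite -zy.
by rewrite distrC.
Qed.

End ChainRule.

(** * Inverse function theorem *)

Section ContractionMatrix.
Variables (R : realType) (m n : nat).

#[local] HB.instance Definition _ := Complete.on 'M[R]_(m, n).

Lemma contraction_closed_ball_mx (x : 'M[R]_(m, n)) (s : R)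
    (Phi : 'M[R]_(m, n) -> 'M[R]_(m, n)) : 0 <= s ->
  (forall z, `|x - z| <= s -> `|x - Phi z| <= s) ->
  (forall z w, `|x - z| <= s -> `|x - w| <= s ->
    `|Phi z - Phi w| <= 2^-1 * `|z - w|) ->
  exists2 z, `|x - z| <= s & z = Phi z.
Proof.
move=> s0 PhiC Phic; pose C := closed_ball_ Num.Def.normr x s.
have PhiC' : set_fun C C Phi by move=> z; exact: PhiC.
pose F : {fun C >-> C} := mkfun PhiC'.
have ctrF : is_contraction F.
  have h0 : 0 <= 2^-1 :> R by [].
  exists (NngNum h0); split => /=; first by rewrite invf_lt1 // ltr1n.
  by move=> [z w] /= [Cz Cw]; exact: Phic.
have [|z Cz zE] := banach_fixed_point ctrF (@closed_closed_ball_ _ _ x s).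
  by exists x; rewrite /C /closed_ball_ /= subrr normr0.
by exists z.
Qed.

End ContractionMatrix.

(** * Strict derivatives and local inverses *)

Section InverseFunction.
Context {R : realType} {n : nat}.
Local Notation E := 'cV[R]_n.
Implicit Types (A V : set E) (x y z : E) (g v : E -> E) (J K : 'M[R]_n).

(** The norm of a matrix is its largest entry, not an operator norm, hence the factor [n]. *)
Lemma mulmx_norm_le K y : `|K *m y| <= n%:R * `|K| * `|y|.
Proof.
apply: norm_mx_le => [|i j]; first by rewrite !mulr_ge0.
rewrite mxE (le_trans (ler_norm_sum _ _ _)) //.
apply: (@le_trans _ _ (\sum_(k < n) `|K| * `|y|)).
  by apply: ler_sum => k _; rewrite normrM ler_pM // coord_le_norm.
by rewrite sumr_const card_ord -mulrA [leRHS]mulr_natl.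
Qed.

Lemma unitmx_inj (F : fieldType) m (A : 'M[F]_m) :
  (forall v : 'cV_m, A *m v = 0 -> v = 0) -> A \in unitmx.
Proof.
move=> A0; rewrite -unitmx_tr -row_free_unit; apply: inj_row_free => v vA.
by apply: trmx_inj; rewrite trmx0; apply: A0; rewrite -[A]trmxK -trmx_mul vA trmx0.
Qed.

(** Both [y] and [z] vary near [x]: this says that [g] minus its linear part has arbitrarily small
    Lipschitz constant on small balls. *)
Definition strict_derivative g x J := forall eps : R, 0 < eps ->
  \forall d \near 0^'+, forall y z, ball x d y -> ball x d z ->
    `|g y - g z - J *m (y - z)| <= eps * `|y - z|.

Lemma C1_strict_derivative A (u : 'I_n -> E -> R) x : open A ->
  (forall i, Ck_on 1 A (u i)) -> A x ->
  strict_derivative (joint_map u) x (jacobian_matrix u x).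
Proof.
move=> oA Cu Ax eps e0.
have nd (i : 'I_n) := C1_strict_differentiable oA (Cu i) Ax e0.
have {}nd : \forall d \near 0^'+, forall i y z, ball x d y -> ball x d z ->
    `|u i y - u i z - (differential (u i) x *m (y - z)) 0 0| <= eps * `|y - z|.
  exact: filter_forall nd.
near=> d => y z xy xz.
apply: norm_mx_le => [|i j]; first by rewrite mulr_ge0 // ltW.
have -> : (joint_map u y - joint_map u z - jacobian_matrix u x *m (y - z)) i j =
    u i y - u i z - (differential (u i) x *m (y - z)) 0 0.
  rewrite ord1 !mxE; congr (_ - _ + - _).
  by apply: eq_bigr => k _; rewrite !mxE.
by move: i y z xy xz {j}; near: d.
Unshelve. all: by end_near. Qed.

Lemma strict_derivative_approx g x J : J \in unitmx -> strict_derivative g x J ->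
  \forall d \near 0^'+, forall y z, ball x d y -> ball x d z ->
    `|invmx J *m (g y - g z) - (y - z)| <= 2^-1 * `|y - z|.
Proof.
(* Multiplication by [K] costs at most [n%:R * |K|], which this [eps] brings down to one half; the
   added 1 keeps the denominator positive. *)
move=> uJ sg; set K := invmx J; pose eps := (2 * (n%:R * `|K| + 1))^-1.
have k0 : 0 <= n%:R * `|K| by rewrite mulr_ge0.
have e0 : 0 < eps by rewrite invr_gt0 mulr_gt0 // ltr_wpDl.
apply: filterS (sg _ e0) => d H y z xy xz.
rewrite -[X in _ - X](mulKmx uJ) -mulmxBr.
apply: le_trans (mulmx_norm_le _ _) _.
apply: le_trans (ler_wpM2l k0 (H y z xy xz)) _.
rewrite mulrA ler_wpM2r // /eps invfM mulrCA ler_piMr //.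
by rewrite ler_pdivrMr ?mul1r ?lerDl // ltr_wpDl.
Qed.

Lemma line_cvg x w : (fun t : R => t *: w + x) @ (0 : R)^' --> x.
Proof.
have h : (fun t : R => t *: w + x) @ (0 : R) --> 0 *: w + x.
  by apply: cvgD; [exact: scalel_continuous|exact: cvg_cst].
by move: h; rewrite scale0r add0r; exact: cvg_within_filter.
Qed.

(** * Maps that an invertible matrix brings half-Lipschitz close to the identity *)

Section Expanding.
Variables (g : E -> E) (V : set E) (K : 'M[R]_n).
Hypothesis oV : open V.
Hypothesis uK : K \in unitmx.
Hypothesis gK : forall y z, V y -> V z ->
  `|K *m (g y - g z) - (y - z)| <= 2^-1 * `|y - z|.

(** A Lipschitz constant for the inverse: absorbing half of |y - z| on the left doubles the bound
    for [K]. The added 1 makes positivity immediate. *)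
Let c := 2 * (n%:R * `|K|) + 1.

Let c0 : 0 < c. Proof. by rewrite /c ltr_wpDl // !mulr_ge0. Qed.

Lemma expanding y z : V y -> V z -> `|y - z| <= c * `|g y - g z|.
Proof.
move=> Vy Vz; have := gK Vy Vz.
have := mulmx_norm_le K (g y - g z).
have : `|y - z| <= `|K *m (g y - g z)| + `|K *m (g y - g z) - (y - z)|.
  by rewrite -{1}(subKr (K *m (g y - g z)) (y - z)) ler_normB.
have := normr_ge0 (g y - g z).
rewrite /c; set a := `|y - z|; set b := `|g y - g z|; set k := `|K *m _|.
set k' := `|_ - _|; set m := n%:R * _ => b0 h1 h2 h3.
by rewrite mulrDl mul1r; lra.
Qed.

Lemma expanding_inj y z : V y -> V z -> g y = g z -> y = z.
Proof.
move=> Vy Vz gyz; have := expanding Vy Vz.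
by rewrite gyz subrr normr0 mulr0 normr_le0 subr_eq0 => /eqP.
Qed.

(** A point [y] near [g x] is reached by Newton's iteration with the derivative frozen at the
    inverse of [K], which contracts a closed ball around [x]. *)
Lemma expanding_open : open (g @` V).
Proof.
rewrite openE => _ [x Vx <-].
have /nbhs_closedballP[s' xV] : nbhs x V by exact: open_near.
have [s s0 s'E] : exists2 s : R, 0 < s & s'%:num = s by exists s'%:num.
rewrite {}s'E in xV.
rewrite closed_ballE // in xV.
set C := closed_ball_ _ _ _ in xV.
(* This radius makes the first iterate move [x] by at most [s / 2]; the contraction accounts for the
   other half of [s]. *)
apply/nbhs_ballP; pose d := s / (2 * (n%:R * `|K| + 1)).
have k0 : 0 <= n%:R * `|K| by rewrite mulr_ge0.
have k10 : 0 < n%:R * `|K| + 1 by rewrite ltr_wpDl.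
have d0 : 0 < d. by rewrite /d divr_gt0 // mulr_gt0.
exists d => //=.
move=> y; rewrite -ball_normE /= => xy.
(* As [K] is invertible, a fixed point is exactly a solution of [g z = y]. *)
pose Phi z := z + K *m (y - g z).
have PhiE z w : Phi z - Phi w = - (K *m (g z - g w) - (z - w)).
  rewrite /Phi opprB opprD addrACA; congr (_ + _).
  by rewrite -mulmxBr -mulmxN !opprB addrC subrKA.
have Phic z w : C z -> C w -> `|Phi z - Phi w| <= 2^-1 * `|z - w|.
  by move=> /xV Vz /xV Vw; rewrite PhiE normrN; exact: gK.
have Cx : C x by rewrite /C /closed_ball_ /= subrr normr0 ltW.
have PhiC z : C z -> `|x - Phi z| <= s.
  move=> Cz.
  rewrite -[X in `|X|](subrKA (Phi x)).
  apply: le_trans (ler_normD _ _) _.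
  have h1 : `|x - Phi x| <= s / 2.
    rewrite /Phi opprD addrA subrr sub0r normrN.
    apply: le_trans (mulmx_norm_le _ _) _.
    rewrite distrC; apply: le_trans (ler_wpM2l k0 (ltW xy)) _.
    rewrite /d invfM mulrCA; apply: ler_wpM2l; first exact: ltW.
    rewrite mulrCA ler_piMr // ler_pdivrMr ?mul1r ?lerDl //.
  have h2 := Phic _ _ Cx Cz.
  have h3 : `|x - z| <= s by exact: Cz.
  lra.
have [z Cz zE] := contraction_closed_ball_mx (ltW s0) PhiC Phic.
exists z; first exact: xV.
move: zE; rewrite /Phi -[LHS]addr0 => /addrI/esym.
move=> /(congr1 (mulmx (invmx K))); rewrite mulKmx // mulmx0.
by move/eqP; rewrite subr_eq0 => /eqP.
Qed.

(** Along a kernel vector of [J] the map [g] would move points by less than expansion permits. This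
    yields invertibility at every point of [V] without any appeal to continuity of the
    determinant. *)
Lemma expanding_unitmx x J : V x -> strict_derivative g x J -> J \in unitmx.
Proof.
move=> Vx sg; apply: unitmx_inj => w Jw.
have e0 : 0 < (2 * c)^-1 by rewrite invr_gt0 mulr_gt0.
have [d [d_gt0 H]] := filter_ex (filterI (nbhs_right_gt (0 : R)) (sg _ e0)).
have : \forall t \near (0 : R)^', V (t *: w + x) /\ ball x d (t *: w + x).
  have ct : (fun t : R => t *: w + x) @ (0 : R)^' --> x by exact: line_cvg.
  apply: filterI; first exact: (ct _ (open_near oV Vx)).
  exact: (ct (ball x d) (nbhsx_ballx x d d_gt0)).
move=> nt; have [t [t0 [Vt xt]]] := filter_ex (filterI (nbhs_dnbhs_neq (0 : R)) nt).
have := H _ _ xt (ballxx x d_gt0).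
rewrite addrK -scalemxAr Jw scaler0 subr0.
have := expanding Vt Vx; rewrite addrK normrZ => h1 h2.
have nt0 : 0 < `|t| by rewrite normr_gt0.
have : `|t| * `|w| <= 2^-1 * (`|t| * `|w|).
  apply: le_trans h1 _; apply: le_trans (ler_wpM2l (ltW c0) h2) _.
  by rewrite invfM mulrCA mulrA mulfVK ?gt_eqF.
move=> h3; have : `|t| * `|w| <= 0 by lra.
by rewrite pmulr_rle0 // normr_le0 => /eqP.
Qed.

Variable v : E -> E.
Hypothesis vV : forall y, (g @` V) y -> V (v y).
Hypothesis gv : forall y, (g @` V) y -> g (v y) = y.

Lemma inverse_lipschitz y z : (g @` V) y -> (g @` V) z ->
  `|v y - v z| <= c * `|y - z|.
Proof.
by move=> Wy Wz; have := expanding (vV Wy) (vV Wz); rewrite !gv.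
Qed.

Lemma inverse_continuous y : (g @` V) y -> {for y, continuous v}.
Proof.
move=> Wy; apply/(@cvgrPdist_le _ _ _ (nbhs y) (nbhs_filter y)) => e e0.
have Wz : nbhs y (g @` V) by exact: (open_near expanding_open Wy).
have yz : nbhs y (ball y (e / c)) by apply: nbhsx_ballx; rewrite divr_gt0.
have Wyz := @filterI _ _ (nbhs_filter y) _ _ Wz yz.
suff H : (g @` V) `&` ball y (e / c) `<=` [set z | `|v y - v z| <= e].
  exact (@filterS _ _ (nbhs_filter y) _ _ H Wyz).
move=> z [{}Wz]; rewrite -ball_normE /= => {}yz.
apply: le_trans (inverse_lipschitz Wy Wz) _.
by rewrite mulrC -ler_pdivlMr // ltW.
Qed.

Lemma inverse_derive J y w : (g @` V) y -> J \in unitmx ->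
  strict_derivative g (v y) J -> is_derive y w v (invmx J *m w).
Proof.
move=> Wy uJ sg; pose N := n%:R * `|invmx J|.
have N0 : 0 <= N by rewrite mulr_ge0.
suff H : (fun h : R => h^-1 *: ((v \o shift y) (h *: w) - v y)) @ 0^' --> invmx J *m w.
  by split; [apply/cvg_ex; exists (invmx J *m w)|exact: cvg_lim].
apply/cvgrPdist_le => e e0.
(* After division by |t| the error is at most [e1] times [N], from the inverse of [J], times
   [c * |w|], from the Lipschitz bound on [v]. *)
pose e1 := e / (N * (c * `|w|) + 1).
have D0 : 0 < N * (c * `|w|) + 1 by rewrite ltr_wpDl // !mulr_ge0 // ltW.
have e10 : 0 < e1 by rewrite divr_gt0.
have [d [d_gt0 H]] := filter_ex (filterI (nbhs_right_gt (0 : R)) (sg _ e10)).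
have ct : (fun t : R => t *: w + y) @ (0 : R)^' --> y by exact: line_cvg.
have vt : (fun t : R => v (t *: w + y)) @ (0 : R)^' --> v y.
  exact: cvg_comp ct (inverse_continuous Wy).
near=> t.
have t0 : t != 0 by near: t; exact: nbhs_dnbhs_neq.
have Wt : (g @` V) (t *: w + y).
  by near: t; exact: (ct _ (open_near expanding_open Wy)).
have xt : ball (v y) d (v (t *: w + y)).
  by near: t; exact: (vt (ball (v y) d) (nbhsx_ballx (v y) d d_gt0)).
rewrite /=; set x' := v (t *: w + y) in xt *; set x := v y in xt H *.
have := H _ _ xt (ballxx x d_gt0); rewrite /x' /x !gv // addrK -/x -/x' => h1.
have h2 : `|x' - x| <= c * (`|t| * `|w|).
  by have := inverse_lipschitz Wt Wy; rewrite addrK normrZ.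
(* The error of the difference quotient of [v] is rewritten as the error of the linear approximation
   of [g], which the strict derivative controls. *)
have -> : invmx J *m w - t^-1 *: (x' - x) =
    t^-1 *: (invmx J *m (t *: w - J *m (x' - x))).
  rewrite [invmx J *m (_ - _)]mulmxBr mulKmx // [RHS]scalerBr.
  by rewrite -scalemxAr scalerA mulVf // scale1r.
rewrite normrZ normfV ler_pdivrMl ?normr_gt0 //.
apply: le_trans (mulmx_norm_le _ _) _; rewrite -/N.
apply: le_trans (ler_wpM2l N0 h1) _.
apply: le_trans (ler_wpM2l N0 (ler_wpM2l (ltW e10) h2)) _.
rewrite (_ : N * _ = `|t| * (e1 * (N * (c * `|w|)))); last by ring.
apply: ler_wpM2l => //; rewrite /e1 mulrAC ler_pdivrMr //.
by rewrite ler_pM2l // lerDl.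
Unshelve. all: by end_near. Qed.

End Expanding.

End InverseFunction.

(** * Jacobians and local coordinates *)

Section Coordinates.
Context {R : realType} {n : nat}.
Local Notation E := 'cV[R]_n.
Implicit Types (A V : set E) (x y p : E) (u : 'I_n -> E -> R).

Lemma smooth_joint_mapP A u : open A ->
  smooth_on A (joint_map u) <-> forall i, smooth_on A (u i).
Proof.
move=> oA; split=> [Su i k|Su k].
  have Ci := (Ck_on_mxP _ _ oA).1 (Su k) i 0.
  by apply: (eq_Ck_on oA) Ci => x _; rewrite mxE.
apply/(Ck_on_mxP _ _ oA) => i j.
by apply: (eq_Ck_on oA) (Su i k) => x _; rewrite mxE.
Qed.

Lemma jacobian_joint_map_comp A (B : set E) u (v : E -> E) x : open A -> open B ->
  (forall i, Ck_on 1 A (u i)) -> Ck_on 1 B v ->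
  A x -> B (joint_map u x) -> (\forall y \near x, v (joint_map u y) = y) ->
  jacobian_matrix (fun i y => v y i 0) (joint_map u x) *m jacobian_matrix u x = 1%:M.
Proof.
move=> oA oB Cu Cv Ax Bux vu; apply/matrixP => i j.
have uE a : (fun z => joint_map u z a 0) = u a by apply/funext => z; rewrite mxE.
have du : derivable (joint_map u) x (delta_mx j 0).
  by apply/derivable_mxP => a b; rewrite ord1 uE; have [] := C1_partial (Cu a) j Ax.
have Cvi : Ck_on 1 B (fun y => v y i 0) by exact: (Ck_on_mxP _ _ oB).1 Cv i 0.
have [_ dvu] := chain_rule oB Cvi Bux du.
have lhs : 'D_(delta_mx j 0) ((fun y => v y i 0) \o joint_map u) x = (i == j)%:R.
  rewrite (@near_eq_derive _ _ _ _ (fun y : E => y i 0)).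
    have := derive_mx (@derivable_id R E x (delta_mx j 0)).
    rewrite derive_id => /(congr1 (fun M : E => M i 0)).
    by rewrite !mxE andbT => ->.
  by apply: filterS vu => y /= ->.
rewrite [RHS]mxE -lhs dvu !mxE; apply: eq_bigr => k _; rewrite !mxE; congr (_ * _).
by have := derive_mx du => /(congr1 (fun M : E => M k 0)); rewrite mxE uE => ->.
Qed.

Lemma coordinates_jacobian_unitmx A u x : open A -> coordinates_on A u -> A x ->
  jacobian_matrix u x \in unitmx.
Proof.
move=> oA [Su ou [v Sv vu]] Ax.
have Cu i := (smooth_joint_mapP u oA).1 Su i 1%N.
have ux : (joint_map u @` A) (joint_map u x) by exists x.
have vu' : \forall y \near x, v (joint_map u y) = y.
  by apply: filterS (open_near oA Ax) => y; exact: vu.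
by have /mulmx1_unit[] := jacobian_joint_map_comp oA ou Cu (Sv 1%N) Ax ux vu'.
Qed.

(** Smoothness of the inverse [v] is a bootstrap: its derivative is the inverse Jacobian composed
    with [v], so [v] of class C^k has derivatives of class C^k and is itself of class C^(k+1). *)
Lemma inverse_function A p u : open A -> A p -> smooth_on A (joint_map u) ->
  jacobian_matrix u p \in unitmx ->
  exists V, [/\ open_nbhs p V, V `<=` A & coordinates_on V u].
Proof.
move=> oA Ap Su uJ; have Sui := (smooth_joint_mapP u oA).1 Su.
have Cu1 i := Sui i 1%N.
have /nbhs_ballP[r/= r0 prA] : nbhs p A by exact: open_near.
have := strict_derivative_approx uJ (C1_strict_derivative oA Cu1 Ap).
move=> /(filterI (nbhs_right_le r0)) /(filterI (nbhs_right_gt (0 : R))).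
move=> /filter_ex[d [d0 [dr gK]]].
pose V := ball p d; pose g := joint_map u; pose K := invmx (jacobian_matrix u p).
have oV : open V by exact: ball_open.
have VA : V `<=` A by move=> x px; apply: prA; exact: le_ball dr _ px.
have uJ' : K \in unitmx by rewrite unitmx_inv.
have oW : open (g @` V) := expanding_open oV uJ' gK.
(* Preimages are chosen inside [V]; the default [p] is only taken off the image. *)
pose v y := xget p [set x | V x /\ g x = y].
have vP y : (g @` V) y -> V (v y) /\ g (v y) = y.
  by move=> [x Vx gx]; apply: (@xgetPex _ p [set x | V x /\ g x = y]); exists x.
have vV y : (g @` V) y -> V (v y) by move=> /vP[].
have gv y : (g @` V) y -> g (v y) = y by move=> /vP[].
have sg x : V x -> strict_derivative g x (jacobian_matrix u x).
  by move=> /VA Ax; exact: (C1_strict_derivative oA Cu1 Ax).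
have uJx x : V x -> jacobian_matrix u x \in unitmx.
  by move=> Vx; exact: (expanding_unitmx oV gK Vx (sg x Vx)).
have dv y w : (g @` V) y -> is_derive y w v (invmx (jacobian_matrix u (v y)) *m w).
  move=> Wy; have Vvy := vV _ Wy.
  exact: (inverse_derive oV uJ' gK vV gv _ Wy (uJx _ Vvy) (sg _ Vvy)).
exists V; split=> //; first by split=> //; exact: ballxx.
split; first by move=> k; exact: Ck_on_sub VA (Su k).
  exact: oW.
exists v; last first.
  move=> x Vx; have Wgx : (g @` V) (g x) by exists x.
  exact: (expanding_inj gK (vV _ Wgx) Vx (gv _ Wgx)).
elim=> [|k IH]; first by move=> y Wy; exact: (inverse_continuous oV uJ' gK vV gv Wy).
split=> [y Wy|i]; first by exact: (inverse_continuous oV uJ' gK vV gv Wy).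
split=> [y Wy|]; first by have [] := dv y (delta_mx i 0) Wy.
suff C : Ck_on k (g @` V)
    (fun y => invmx (jacobian_matrix u (v y)) *m (delta_mx i 0 : E)).
  by apply: (eq_Ck_on oW) C => y Wy; have [_ <-] := dv y (delta_mx i 0) Wy.
apply/(Ck_on_mxP _ _ oW) => a b.
have CJ a' b' : Ck_on k V (fun x => jacobian_matrix u x a' b').
  have [_ /(_ b')[_ C]] := Sui a' k.+1.
  by apply: (eq_Ck_on oV) (Ck_on_sub VA C) => x _; rewrite mxE.
have := Ck_on_comp oV oW vV IH (Ck_on_invmx oV uJx CJ a i).
apply: (eq_Ck_on oW) => y _ /=.
rewrite mxE (bigD1 i) //= big1 ?addr0 ?mxE ?eqxx ?ord1 ?mulr1 //.
by move=> j /negbTE ji; rewrite mxE ji mulr0.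
Qed.

End Coordinates.

(** * Cyclic vectors and skew forms *)

Section CyclicVectors.
Context {F : fieldType} {n : nat}.

Lemma free_mkseq_row (f : nat -> 'rV[F]_n) :
  free (mkseq f n) <-> \matrix_(i < n) f i \in unitmx.
Proof.
pose X : n.-tuple 'rV[F]_n := @Tuple n _ (mkseq f n) (introT eqP (size_mkseq f n)).
have XE (k : 'I_n -> F) :
    \sum_(i < n) k i *: X`_i = (\row_i k i) *m \matrix_(i < n) f i.
  by rewrite mulmx_sum_row; apply: eq_bigr => i _; rewrite mxE rowK nth_mkseq.
split=> [/(@freeP _ _ _ X) fX|uX].
  rewrite -row_free_unit; apply: inj_row_free => v vX.
  apply/rowP => i; rewrite [RHS]mxE; apply: (fX (fun i => v 0 i)).
  by rewrite XE -[RHS]vX; congr (_ *m _); apply/rowP => j; rewrite mxE.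
apply/(@freeP _ _ _ X) => k; rewrite XE.
move=> /(congr1 (mulmx^~ (invmx (\matrix_(i < n) f i)))).
by rewrite mulmxK // mul0mx => /rowP k0 i; have := k0 i; rewrite !mxE.
Qed.

Lemma free_mkseq_col (f : nat -> 'cV[F]_n) :
  free (mkseq f n) -> \matrix_(i, j < n) f j i 0 \in unitmx.
Proof.
pose X : n.-tuple 'cV[F]_n := @Tuple n _ (mkseq f n) (introT eqP (size_mkseq f n)).
move=> /(@freeP _ _ _ X) fX; apply: unitmx_inj => v vX.
apply/colP => i; rewrite [RHS]mxE; apply: (fX (fun i => v i 0)).
rewrite -[RHS]vX; apply/colP => a; rewrite summxE mxE; apply: eq_bigr => j _.
by rewrite nth_mkseq // !mxE mulrC.
Qed.

End CyclicVectors.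

Section SkewForms.
Context {F : numFieldType} {n : nat}.
Implicit Types (L B : 'M[F]_n) (w : 'cV[F]_n).

Lemma adjoint_expr L B k : L^T *m B = B *m L -> (L ^+ k)^T *m B = B *m L ^+ k.
Proof.
move=> LB; elim: k => [|k IH]; first by rewrite expr0 trmx1 mul1mx mulmx1.
rewrite exprS -[L * _]/(L *m _) trmx_mul -mulmxA LB mulmxA IH -!mulmxA.
by congr (_ *m _); rewrite -[LHS]/(L ^+ k * L) -exprSr exprS.
Qed.

(* [B (L^a w, L^b w) = B (w, L^(a+b) w)] is both symmetric and skew. *)
Lemma cyclic_skew_eq0 L B w : free (mkseq (fun k => L ^+ k *m w) n) ->
  B^T = - B -> L^T *m B = B *m L -> B = 0.
Proof.
move=> /free_mkseq_col; set Z := \matrix_(i, j) _ => uZ skew LB.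
have q0 k : w^T *m B *m (L ^+ k *m w) = 0.
  set q := _ *m _; have qT : q^T = - q.
    rewrite /q !trmx_mul trmxK skew !mulNmx mulmxN; congr (- _).
    by rewrite !mulmxA -(mulmxA w^T (L ^+ k)^T) adjoint_expr // !mulmxA.
  (* A 1 x 1 matrix equals its transpose, so q = -q, and characteristic zero gives q = 0. *)
  have qTq : q^T = q by apply/matrixP => i j; rewrite mxE !ord1.
  apply/matrixP => i j; move: qT; rewrite qTq => /matrixP/(_ i j).
  rewrite !mxE => /eqP.
  by rewrite -addr_eq0 -mulr2n mulrn_eq0 /= => /eqP.
(* The columns of [Z] are the basis generated by the cyclic vector, so this is the Gram matrix of
   [B] in that basis. *)
have ZBZ : Z^T *m B *m Z = 0.
  apply/matrixP => a b.
  have -> : (Z^T *m B *m Z) a b = ((L ^+ a *m w)^T *m B *m (L ^+ b *m w)) 0 0.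
    rewrite !mxE; apply: eq_bigr => k _; congr (_ * _); last by rewrite mxE.
    by rewrite !mxE; apply: eq_bigr => i _; rewrite !mxE.
  suff -> : (L ^+ a *m w)^T *m B *m (L ^+ b *m w) = 0 by rewrite !mxE.
  rewrite -[RHS](q0 (a + b)%N) trmx_mul -(mulmxA w^T (L ^+ a)^T) adjoint_expr // exprD.
  by rewrite -[L ^+ a * _]/(L ^+ a *m _) !mulmxA.
have : invmx Z^T *m (Z^T *m B *m Z) *m invmx Z = B.
  by rewrite -!mulmxA mulmxV // mulmx1 mulKmx // unitmx_tr.
by rewrite ZBZ mulmx0 mul0mx => <-.
Qed.

Lemma bilinear_form_inj (P Q : 'M[F]_n) :
  (forall a b : 'cV[F]_n, (a^T *m P *m b) 0 0 = (a^T *m Q *m b) 0 0) -> P = Q.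
Proof.
have E (M : 'M[F]_n) i j :
    M i j = ((delta_mx i 0 : 'cV[F]_n)^T *m M *m (delta_mx j 0 : 'cV_n)) 0 0.
  by rewrite trmx_delta -rowE -colE !mxE.
by move=> PQ; apply/matrixP => i j; rewrite !E PQ.
Qed.

End SkewForms.

(** * Differentials of operator fields *)

Section MatrixCalculus.
Context {R : realType} {n : nat}.
Local Notation E := 'cV[R]_n.

Lemma is_derive_mxP m q (F : E -> 'M[R]_(m, q)) x v (dF : 'M[R]_(m, q)) :
  is_derive x v F dF <-> forall i j, is_derive x v (fun y => F y i j) (dF i j).
Proof.
split=> [[df <-] i j|dFij].
  by split; [exact: (derivable_mxP _ _ _).1 df i j|rewrite derive_mx // mxE].
have df : derivable F x v by apply/derivable_mxP => i j; have [] := dFij i j.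
split=> //; rewrite derive_mx //; apply/matrixP => i j; rewrite mxE.
by have [_ ->] := dFij i j.
Qed.

Lemma is_derive_mulmx m q s (P : E -> 'M[R]_(m, q)) (Q : E -> 'M[R]_(q, s)) x v dP dQ :
  is_derive x v P dP -> is_derive x v Q dQ ->
  is_derive x v (fun y => P y *m Q y) (dP *m Q x + P x *m dQ).
Proof.
move=> /is_derive_mxP dPij /is_derive_mxP dQij; apply/is_derive_mxP => i j.
have := @is_derive_sum _ _ _ _ _ x v _
  (fun k => is_deriveM (dPij i k) (dQij k j)).
rewrite (_ : \sum_(_ < _) _ = fun y => (P y *m Q y) i j); last first.
  by apply/funext => y; rewrite mxE fct_sumE.
move=> /is_derive_eq; apply; rewrite !mxE -big_split /=; apply: eq_bigr => k _.
by rewrite addrC; congr (_ + _); exact: mulrC.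
Qed.

(** Built from partials so that additivity in [v], which polarization relies on, is immediate; for
    C^1 fields it is the directional derivative. *)
Definition mx_derivative m q (F : E -> 'M[R]_(m, q)) x (v : E) : 'M[R]_(m, q) :=
  \sum_i v i 0 *: partial i F x.

Lemma mx_derivativeD m q (F : E -> 'M[R]_(m, q)) x v w :
  mx_derivative F x (v + w) = mx_derivative F x v + mx_derivative F x w.
Proof.
by rewrite -big_split /=; apply: eq_bigr => i _; rewrite mxE scalerDl.
Qed.

Lemma C1_mx_derivative A m q (F : E -> 'M[R]_(m, q)) x v : open A -> Ck_on 1 A F ->
  A x -> is_derive x v F (mx_derivative F x v).
Proof.
move=> oA CF Ax; apply/is_derive_mxP => i j.
have CFij := (Ck_on_mxP _ _ oA).1 CF i j.
have [df dfE] := C1_derive v oA CFij Ax; split=> //.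
rewrite dfE mxE summxE; apply: eq_bigr => k _; rewrite !mxE mulrC; congr (_ * _).
by rewrite partial_mx //; have [_ /(_ k)[+ _]] := CF; exact.
Qed.

End MatrixCalculus.

(** * Symmetries *)

Section SymmetryAlgebra.
Context {R : comNzRingType} {n : nat}.
Local Notation E := 'cV[R]_n.
Variables (l m H : 'M[R]_n) (P Q : E -> 'M[R]_n).
Implicit Types a b c d : E.

(* The value of [<L, M>] on constant vector fields [a] and [b], where [l], [m]
   are the values of [L], [M] at a point and [P a], [Q a] their derivatives in
   the direction [a]. *)
Definition symmetry_defect a b : E :=
  - (m *m (P b *m a)) + l *m (Q a *m b) - Q (l *m a) *m b + P (m *m b) *m a.

Hypothesis PD : forall a b, P (a + b) = P a + P b.
Hypothesis QD : forall a b, Q (a + b) = Q a + Q b.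

Lemma symmetry_defect_polarization :
  (forall c, symmetry_defect c c = 0) ->
  forall a b, symmetry_defect a b + symmetry_defect b a = 0.
Proof.
have rearr (p p' q q' r r' s s' : E) : - (p + p') + (q + q') - (r + r') + (s + s') =
    (- p + q - r + s) + (- p' + q' - r' + s').
  rewrite !opprD [RHS]addrACA; congr (_ + _); rewrite [RHS]addrACA; congr (_ + _).
  exact: addrACA.
have SDl c d e : symmetry_defect (c + d) e = symmetry_defect c e + symmetry_defect d e.
  by rewrite /symmetry_defect !(mulmxDr, PD, QD, mulmxDl); exact: rearr.
have SDr c d e : symmetry_defect e (c + d) = symmetry_defect e c + symmetry_defect e d.
  by rewrite /symmetry_defect !(mulmxDr, PD, QD, mulmxDl); exact: rearr.
by move=> S0 a b; have := S0 (a + b); rewrite SDl !SDr !S0 add0r addr0.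
Qed.

Variable phi : E -> R.
Hypothesis phiD : forall a b, phi (a + b) = phi a + phi b.
Hypothesis phiN : forall a, phi (- a) = - phi a.

(** The value of d(N^* df) on the constant fields [a] and [b], when [H] is the Hessian of [f], [phi]
    is df and [DN] is the derivative of [N] at the point. *)
Definition pullback_differential (N : 'M[R]_n) (DN : E -> 'M[R]_n) a b : R :=
  (a^T *m H *m (N *m b)) 0 0 - (b^T *m H *m (N *m a)) 0 0
  + phi (DN a *m b) - phi (DN b *m a).

Hypothesis lm : l *m m = m *m l.
Hypothesis symH : H^T = H.
Hypothesis Plm : forall c, P c *m m + l *m Q c = Q c *m l + m *m P c.
Hypothesis closedL : forall a b, pullback_differential l P a b = 0.
Hypothesis symM : forall a b, symmetry_defect a b + symmetry_defect b a = 0.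

(** Write B_N for [pullback_differential N DN]. Once the terms [l *m Q] are eliminated by the
    derivative of LM = ML, the difference B_m(la, b) - B_m(a, lb) is B_l(ma, b) + B_l(mb, a) minus
    [phi] of the symmetrized defect, and these three vanish by hypothesis. *)
Lemma pullback_differential_adjoint a b :
  pullback_differential m Q (l *m a) b = pullback_differential m Q a (l *m b).
Proof.
have lQ c d : phi (l *m (Q c *m d)) =
    phi (Q c *m (l *m d)) + phi (m *m (P c *m d)) - phi (P c *m (m *m d)).
  have := congr1 (fun N => phi (N *m d)) (Plm c).
  rewrite !mulmxDl !phiD -!mulmxA => E; rewrite -E.
  by rewrite addrAC subrr add0r.
have hs c d : (c^T *m H *m d) 0 0 = (d^T *m H *m c) 0 0.
  rewrite -{1}symH.
  by rewrite (_ : c^T *m _ *m d = (d^T *m H *m c)^T) ?mxE // !trmx_mul trmxK mulmxA.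
have phi0 : phi 0 = 0 by apply: (@addrI _ (phi 0)); rewrite -phiD !addr0.
have := closedL (m *m b) a; have := closedL (m *m a) b.
have := congr1 phi (symM a b); rewrite phi0 /symmetry_defect !(phiD, phiN) !lQ.
have lmv (c : E) : l *m (m *m c) = m *m (l *m c) by rewrite !mulmxA lm.
rewrite /pullback_differential !lmv.
rewrite (hs (m *m b) (l *m a)) (hs (m *m a) (l *m b)) (hs (l *m b) (m *m a)).
set t1 := phi (Q (l *m a) *m b); set t2 := phi (Q (l *m b) *m a).
set t3 := phi (Q a *m _); set t4 := phi (Q b *m _).
set t5 := phi (m *m (P b *m _)); set t6 := phi (m *m (P a *m _)).
set t7 := phi (P a *m _); set t8 := phi (P b *m _).
set t9 := phi (P (m *m b) *m _); set t10 := phi (P (m *m a) *m _).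
set h1 := ((m *m a)^T *m H *m (l *m b)) 0 0.
set h2 := (b^T *m H *m _) 0 0; set h3 := ((l *m a)^T *m H *m (m *m b)) 0 0.
set h4 := (a^T *m H *m _) 0 0.
clearbody t1 t2 t3 t4 t5 t6 t7 t8 t9 t10 h1 h2 h3 h4 => e1 e2 e3.
apply: subr0_eq; rewrite -[RHS](subr0 (0 : R)) -{2}e1 -{1}(addr0 (0 : R)) -{1}e2 -{1}e3.
ring.
Qed.

End SymmetryAlgebra.

Section Symmetries.
Context {R : realType} {n : nat}.
Local Notation E := 'cV[R]_n.
Implicit Types (A : set E) (L M N : E -> 'M[R]_n) (f : E -> R) (x a b : E).

Definition hessian f x : 'M[R]_n := \matrix_(i, j) partial i (partial j f) x.

Lemma hessian_sym A f x : open A -> Ck_on 2 A f -> A x -> (hessian f x)^T = hessian f x.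
Proof. by move=> oA Cf Ax; apply/matrixP => i j; rewrite !mxE (partialC _ _ oA Cf). Qed.

Lemma partial_pullback A f N x i j : open A -> Ck_on 2 A f -> Ck_on 1 A N -> A x ->
  partial i (fun y => op_pullback N (differential f) y 0 j) x =
  (hessian f x *m N x) i j + (differential f x *m partial i N x) 0 j.
Proof.
move=> oA Cf CN Ax.
have dN : is_derive x (delta_mx i 0) N (partial i N x).
  by split=> //; have [_ /(_ i)[+ _]] := CN; exact.
have dF : is_derive x (delta_mx i 0) (differential f) (row i (hessian f x)).
  apply/is_derive_mxP => a k; rewrite (_ : (fun _ => _) = partial k f); last first.
    by apply/funext => y; rewrite mxE.
  rewrite !mxE; split=> //.
  by have [_ /(_ k)[_ Ck]] := Cf; have [] := C1_partial Ck i Ax.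
have /is_derive_mxP/(_ 0 j)[_ +] := is_derive_mulmx dF dN.
by rewrite -row_mul [RHS]mxE mxE.
Qed.

(** The product rule splits the matrix of first derivatives of N^* df into Hessian times [N] and a
    part [G] with df applied to the derivatives of [N]; the exterior derivative antisymmetrizes
    each. *)
Lemma ext_deriv_pullback A f N x a b : open A -> Ck_on 2 A f -> Ck_on 1 A N -> A x ->
  (a^T *m ext_deriv (op_pullback N (differential f)) x *m b) 0 0 =
  (a^T *m hessian f x *m (N x *m b)) 0 0 - (b^T *m hessian f x *m (N x *m a)) 0 0
  + linear_form (differential f x) (mx_derivative N x a *m b)
  - linear_form (differential f x) (mx_derivative N x b *m a).
Proof.
move=> oA Cf CN Ax.
pose G := \matrix_(i, j) (differential f x *m partial i N x) 0 j.
have GE (v w : E) : linear_form (differential f x) (mx_derivative N x v *m w) =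
    (v^T *m G *m w) 0 0.
  rewrite /linear_form mulmxA; congr ((_ *m w) 0 0).
  rewrite /mx_derivative mulmx_sumr; apply/rowP => j; rewrite summxE mxE.
  by apply: eq_bigr => i _; rewrite -scalemxAr !mxE.
have gE i j : (differential f x *m partial i N x) 0 j = G i j by rewrite [RHS]mxE.
have PE i j := partial_pullback i j oA Cf CN Ax.
have -> : ext_deriv (op_pullback N (differential f)) x =
    hessian f x *m N x - (hessian f x *m N x)^T + G - G^T.
  have skewE (P Q : 'M[R]_n) i j :
      (P - P^T + Q - Q^T) i j = P i j + Q i j - (P j i + Q j i).
    by rewrite !mxE opprD addrACA addrA.
  by apply/matrixP => i j; rewrite [LHS]mxE skewE -!gE -!PE.
have tr (P : 'M[R]_n) : (a^T *m P^T *m b) 0 0 = (b^T *m P *m a) 0 0.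
  by rewrite (_ : a^T *m P^T *m b = (b^T *m P *m a)^T) ?mxE // !trmx_mul trmxK mulmxA.
have qD (P Q : 'M[R]_n) :
    (a^T *m (P + Q) *m b) 0 0 = (a^T *m P *m b) 0 0 + (a^T *m Q *m b) 0 0.
  by rewrite mulmxDr mulmxDl mxE.
have qN (P : 'M[R]_n) : (a^T *m - P *m b) 0 0 = - (a^T *m P *m b) 0 0.
  by rewrite mulmxN mulNmx mxE.
by rewrite !GE !qD !qN !tr !mulmxA.
Qed.

Lemma lie_bracket_cst_r (xi : E -> E) b x (d : E) :
  is_derive x b xi d -> lie_bracket xi (cst b) x = - d.
Proof. by move=> [_ dE]; rewrite /lie_bracket derive_cst sub0r dE. Qed.

Lemma lie_bracket_cst_l (xi : E -> E) b x (d : E) :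
  is_derive x b xi d -> lie_bracket (cst b) xi x = d.
Proof. by move=> [_ dE]; rewrite /lie_bracket derive_cst subr0 dE. Qed.

Lemma is_derive_op_apply_cst A N x v b : open A -> Ck_on 1 A N -> A x ->
  is_derive x v (op_apply N (cst b)) (mx_derivative N x v *m b).
Proof.
move=> oA CN Ax.
have := is_derive_mulmx (C1_mx_derivative v oA CN Ax) (is_derive_cst b x v).
by rewrite mulmx0 addr0.
Qed.

(** A bracket with a constant field keeps one directional derivative and [a, a] vanishes, so only
    [La, Ma] contributes two terms. *)
Lemma sym_bracket_cst A L M x a : open A -> Ck_on 1 A L -> Ck_on 1 A M -> A x ->
  sym_bracket L M (cst a) (cst a) x =
    symmetry_defect (L x) (M x) (mx_derivative L x) (mx_derivative M x) a a.
Proof.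
move=> oA CL CM Ax; have dL v := is_derive_op_apply_cst v a oA CL Ax.
have dM v := is_derive_op_apply_cst v a oA CM Ax.
rewrite -[LHS]/(M x *m lie_bracket (op_apply L (cst a)) (cst a) x
  + L x *m lie_bracket (cst a) (op_apply M (cst a)) x
  - lie_bracket (op_apply L (cst a)) (op_apply M (cst a)) x
  - L x *m (M x *m lie_bracket (cst a) (cst a) x)).
rewrite (lie_bracket_cst_r (dL _)) (lie_bracket_cst_l (dM _)).
rewrite (lie_bracket_cst_l (is_derive_cst a x a)) !mulmx0 subr0 mulmxN /symmetry_defect.
have -> : lie_bracket (op_apply L (cst a)) (op_apply M (cst a)) x =
    mx_derivative M x (L x *m a) *m a - mx_derivative L x (M x *m a) *m a.
  by rewrite /lie_bracket; have [_ ->] := dM (L x *m a); have [_ ->] := dL (M x *m a).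
by rewrite opprB addrA addrAC.
Qed.

Lemma conservation_law_symmetry A L M f x :
  open A -> Ck_on 1 A L -> symmetry_on A L M -> Ck_on 2 A f ->
  ext_deriv (op_pullback L (differential f)) x = 0 -> A x ->
  (exists w : E, free (mkseq (fun k => L x ^+ k *m w) n)) ->
  ext_deriv (op_pullback M (differential f)) x = 0.
Proof.
move=> oA CL [SM LM symM] Cf L0 Ax [w wP]; have CM := SM 1%N.
apply: (cyclic_skew_eq0 wP).
  by apply/matrixP => i j; rewrite !mxE opprB.
apply: bilinear_form_inj => a b.
have EL := ext_deriv_pullback _ _ oA Cf CL Ax.
have EM := ext_deriv_pullback _ _ oA Cf CM Ax.
have := @pullback_differential_adjoint R n (L x) (M x) (hessian f x) (mx_derivative L x)
  (mx_derivative M x) (linear_form (differential f x)) (linearD _) (linearN _)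
  (LM x Ax) (hessian_sym oA Cf Ax).
rewrite /pullback_differential => H.
rewrite (_ : a^T *m ((L x)^T *m _) *m b = (L x *m a)^T *m
  ext_deriv (op_pullback M (differential f)) x *m b); last by rewrite trmx_mul !mulmxA.
rewrite (_ : a^T *m (_ *m L x) *m b = a^T *m
  ext_deriv (op_pullback M (differential f)) x *m (L x *m b)); last by rewrite !mulmxA.
rewrite !EM; apply: H => [c|c d|c d].
(* LM and ML agree on an open set, so their product-rule derivatives agree at [x]. *)
- have dL := C1_mx_derivative c oA CL Ax; have dM := C1_mx_derivative c oA CM Ax.
  have [_ <-] := is_derive_mulmx dL dM; have [_ <-] := is_derive_mulmx dM dL.
  by apply: near_eq_derive; apply: filterS (open_near oA Ax) => y; exact: LM.
- by rewrite -EL L0 mulmx0 mul0mx mxE.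
- apply: symmetry_defect_polarization => [||e]; [exact: mx_derivativeD..|].
  by rewrite -(sym_bracket_cst e oA CL CM Ax) symM // => k; exact: Ck_on_cst.
Qed.

End Symmetries.

(** * Companion form *)

Section CompanionForm.
Context {R : realType} {n : nat}.
Local Notation E := 'cV[R]_n.
Implicit Types (A : set E) (L : E -> 'M[R]_n) (f u v : 'I_n -> E -> R) (x p : E).

Lemma partial_addcst (f : E -> R) c i : partial i (fun x => f x + c) = partial i f.
Proof.
apply/funext => x; rewrite /partial /derive.
set g1 := fun h => h^-1 *: _; set g2 := fun h => h^-1 *: _.
suff -> : g1 = g2 by [].
by apply/funext => h; rewrite /g1 /g2 /= opprD addrACA subrr addr0.
Qed.

Lemma jacobian_matrix_addcst f (c : 'I_n -> R) :
  jacobian_matrix (fun i x => f i x + c i) = jacobian_matrix f.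
Proof. by apply/funext => x; apply/matrixP => i j; rewrite !mxE partial_addcst. Qed.

Lemma row_jacobian_matrix f x i : row i (jacobian_matrix f x) = differential (f i) x.
Proof. by apply/rowP => j; rewrite !mxE. Qed.

Lemma smooth_on_addcst A (f : E -> R) (c : R) : open A ->
  smooth_on A f -> smooth_on A (fun x => f x + c).
Proof. by move=> oA Sf k; exact: (Ck_onD oA (Sf k) (Ck_on_cst k A c)). Qed.

Lemma exact_form_closed A (f : E -> R) (alpha : E -> 'rV[R]_n) : open A ->
  Ck_on 2 A f -> (forall x, A x -> alpha x = differential f x) ->
  closed_form_on A alpha.
Proof.
move=> oA Cf alphaE x Ax; apply/matrixP => i j; rewrite !mxE.
have aE k y : A y -> alpha y 0 k = partial k f y by move=> Ay; rewrite alphaE // mxE.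
rewrite (eq_on_partial i oA (aE j) Ax) (eq_on_partial j oA (aE i) Ax).
by rewrite (partialC _ _ oA Cf Ax) subrr.
Qed.

(** The coefficients are precisely the last row of [comp2 B]. *)
Lemma Cayley_Hamilton_expr (B : 'M[R]_n) (a : 'rV[R]_n) : (0 < n)%N ->
  a *m B ^+ n = \sum_(j < n) sigma B (n - j) *: (a *m B ^+ j).
Proof.
case: n B a => // m B a _; set c := char_poly B.
have c1 : c`_m.+1 = 1.
  by have := char_poly_monic B; rewrite monicE lead_coefE size_char_poly => /eqP.
have : horner_mx B c = \sum_(j < m.+2) c`_j *: B ^+ j.
  rewrite -{1}(coefK c) poly_def size_char_poly linear_sum; apply: eq_bigr => j _.
  by rewrite linearZ rmorphXn /= horner_mx_X.
rewrite Cayley_Hamilton big_ord_recr /= c1 scale1r => /esym/eqP.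
rewrite addrC addr_eq0 => /eqP ->; rewrite mulmxN mulmx_sumr -sumrN.
apply: eq_bigr => j _; rewrite /sigma subKn; last exact: ltnW.
by rewrite scaleNr -scalemxAr.
Qed.

(* Row [i] of [J L = comp2(L) J] reads [L^* df_i = df_(i+1)], and the last row
   is the Cayley-Hamilton identity. *)
Lemma comp2_rows (B J : 'M[R]_n) (r : 'I_n) : (0 < n)%N -> r = 0%N :> nat ->
  J *m B = comp2 B *m J <-> forall i : 'I_n, row i J = row r J *m B ^+ i.
Proof.
move=> n0 r0.
have compE (i : 'I_n) (k : 'I_n) : k = i.+1 :> nat -> row i (comp2 B *m J) = row k J.
  move=> ki; have iSn : (i.+1 == n) = false by rewrite -ki ltn_eqF.
  rewrite row_mul mulmx_sum_row (bigD1 k) //= big1 ?addr0 => [|j jk].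
    by rewrite !mxE iSn ki eqxx scale1r.
  by rewrite !mxE iSn -ki -[(j == k :> nat)]/(j == k) (negbTE jk) scale0r.
split=> [JB|JB].
  move=> i; case: i => i; elim: i => [|i IH] iSn.
    by rewrite expr0 mulmx1; congr (row _ J); apply: val_inj.
  have iltn := ltnW iSn; rewrite -(compE (Ordinal iltn)) //= -JB row_mul IH.
  by rewrite exprSr mulmxA.
apply/row_matrixP => i; rewrite row_mul.
have step : row i J *m B = row r J *m B ^+ i.+1 by rewrite JB exprSr mulmxA.
have [iSn|] := ltnP i.+1 n.
  by rewrite (compE i (Ordinal iSn)) // step [RHS]JB.
move=> ni; have iE : i.+1 = n by apply/eqP; rewrite eqn_leq ni ltn_ord.
rewrite step iE Cayley_Hamilton_expr // row_mul mulmx_sum_row.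
by apply: eq_bigr => j _; rewrite (JB j); congr (_ *: _); rewrite !mxE iE eqxx.
Qed.

Lemma hierarchy_rows A L f (r : 'I_n) x : hierarchy_on A L f -> r = 0%N :> nat -> A x ->
  forall i, differential (f i) x = differential (f r) x *m L x ^+ i.
Proof.
move=> [_ _ Hf] r0 Ax [i]; elim: i => [|i IH] iSn.
  by rewrite expr0 mulmx1; congr (differential (f _) x); apply: val_inj.
have iltn := ltnW iSn.
rewrite -(Hf (Ordinal iltn) (Ordinal iSn)) // /op_pullback IH.
by rewrite exprSr mulmxA.
Qed.

Lemma regular_hierarchy_comp2 A L f x : (0 < n)%N ->
  regular_hierarchy_on A L f -> A x ->
  jacobian_matrix f x \in unitmx /\ matrix_in_coordinates L f x = comp2 (L x).
Proof.
move=> n0 [Hf regf] Ax; pose r : 'I_n := Ordinal n0.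
have rows := hierarchy_rows Hf (erefl : r = 0%N :> nat) Ax.
have uJ : jacobian_matrix f x \in unitmx.
  have /free_mkseq_row := regf r erefl x Ax; congr (_ \in unitmx).
  by apply/row_matrixP => i; rewrite rowK row_jacobian_matrix [RHS]rows.
split=> //; rewrite /matrix_in_coordinates.
have /(comp2_rows _ _ n0 (erefl : r = 0%N :> nat)) -> : forall i : 'I_n,
    row i (jacobian_matrix f x) = row r (jacobian_matrix f x) *m L x ^+ i.
  by move=> i; rewrite !row_jacobian_matrix.
by rewrite mulmxK.
Qed.

Lemma comp2_regular_hierarchy A L f : (0 < n)%N -> open A ->
  (forall i, smooth_on A (f i)) ->
  (forall x, A x -> jacobian_matrix f x \in unitmx) ->
  (forall x, A x -> matrix_in_coordinates L f x = comp2 (L x)) ->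
  regular_hierarchy_on A L f.
Proof.
move=> n0 oA Sf uJ comp.
have rows x (r i : 'I_n) : A x -> r = 0%N :> nat ->
    differential (f i) x = differential (f r) x *m L x ^+ i.
  move=> Ax r0; rewrite -!row_jacobian_matrix; apply: (comp2_rows _ _ n0 r0).1.
  by rewrite -comp // mulmxKV // uJ.
pose r : 'I_n := Ordinal n0.
have next (i j : 'I_n) : j = i.+1 :> nat -> forall x, A x ->
    op_pullback L (differential (f i)) x = differential (f j) x.
  move=> ji x Ax; rewrite (rows x r j Ax) // ji exprSr -[L x ^+ i * _]/(_ *m _) mulmxA.
  by rewrite -rows.
split; first split=> // i i0; last first.
  move=> i i0 x Ax; apply/free_mkseq_row; have := uJ x Ax; congr (_ \in unitmx).
  by apply/row_matrixP => k; rewrite rowK row_jacobian_matrix (rows x i k).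
(* L^* df_1 is closed because it equals df_2. In dimension one there is no f_2, but there every
   1-form is closed. *)
split=> //; have [n1|n1] := ltnP 1 n.
  apply: (exact_form_closed oA (Sf (Ordinal n1) 2%N)).
  by apply: next; rewrite i0.
move=> x Ax; apply/matrixP => a b; rewrite !mxE.
have ord_eq0 (k : 'I_n) : k = 0%N :> nat.
  by apply/eqP; rewrite -leqn0 -ltnS; exact: leq_trans (ltn_ord k) n1.
have -> : a = b by apply: val_inj; rewrite /= !ord_eq0.
by rewrite subrr.
Qed.

(** On a ball the difference has zero partials, and [increment_le] with zero slopes and zero error
    makes it constant. *)
Lemma eq_differential_near A p (g h : E -> R) :
  open A -> A p -> Ck_on 1 A g -> Ck_on 1 A h ->
  g p = h p -> (\forall x \near p, differential g x = differential h x) ->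
  \forall x \near p, g x = h x.
Proof.
move=> oA Ap Cg Ch gh dgh.
have /nbhs_ballP[r/= r0 pr] : nbhs p (A `&`
    [set x | differential g x = differential h x]).
  exact: filterI (open_near oA Ap) dgh.
have pB : nbhs p (ball p r) by exact: nbhsx_ballx.
apply: filterS pB => x px.
have H z i : ball p r z ->
    derivable (g - h) z (delta_mx i 0) /\ `|partial i (g - h) z - 0| <= 0.
  move=> /pr[Az dE]; have [dg _] := C1_partial Cg i Az.
  have [dh _] := C1_partial Ch i Az.
  split; first exact: derivableB.
  have : partial i g z = partial i h z by move/rowP: dE => /(_ i); rewrite !mxE.
  by rewrite /partial (deriveB dg dh) => ->; rewrite subrr subr0 normr0.
have := increment_le H (ballxx p r0) px.
rewrite big1 => [|i _]; last by rewrite mul0r.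
rewrite mulr0 mul0r subr0 normr_le0 -!/(_ - _) => /eqP.
have -> : (g - h) x - (g - h) p = g x - h x - (g p - h p) by [].
by rewrite gh subrr subr0 => /eqP; rewrite subr_eq0 => /eqP.
Qed.

End CompanionForm.

Theorem theorem1p3 (R : realType) (n : nat) (n_gt0 : (0 < n)%N)
    (U : set 'cV[R]_n) (p : 'cV[R]_n) (L : 'cV[R]_n -> 'M[R]_n)
    (Up : open_nbhs p U) (L_smooth : smooth_on U L)
    (L_nijenhuis : nijenhuis_on U L) (L_regular : gl_regular_on U L) :
  [/\ (* every conservation law of L is one for every symmetry of L *)
      forall (V : set 'cV[R]_n) (f : 'cV[R]_n -> R) (M : 'cV[R]_n -> 'M[R]_n),
        open_nbhs p V -> V `<=` U ->
        conservation_law_on V L f -> symmetry_on V L M ->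
        conservation_law_on V M f,
      (* regular hierarchies correspond to centred companion coordinates *)
      forall f : 'I_n -> 'cV[R]_n -> R,
        let u := fun (i : 'I_n) (x : 'cV[R]_n) => f i x - f i p in
        regular_hierarchy_near U p L f <->
        second_companion_coordinates_near U p L u /\ centred_at p u,
      (* the coordinates are determined by their hierarchy *)
      forall u v : 'I_n -> 'cV[R]_n -> R,
        second_companion_coordinates_near U p L u -> centred_at p u ->
        second_companion_coordinates_near U p L v -> centred_at p v ->
        (\forall x \near p, forall i, differential (u i) x = differential (v i) x) ->
        \forall x \near p, forall i, u i x = v i x &
      (exists f : 'I_n -> 'cV[R]_n -> R, regular_hierarchy_near U p L f) <->
        reducible_to_comp2_near U p L].
Proof.
have Up' : U p by case: Up.
have oU : open U by case: Up.
have to_companion f : regular_hierarchy_near U p L f ->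
    second_companion_coordinates_near U p L (fun i x => f i x - f i p).
  move=> [V [[oV Vp] VU Hf]]; have [[Sf _ _] _] := Hf.
  have JE := jacobian_matrix_addcst f (fun i => - f i p).
  have Sfp : smooth_on V (joint_map (fun i x => f i x - f i p)).
    by apply/smooth_joint_mapP => // i; exact: smooth_on_addcst.
  have uJ : jacobian_matrix (fun i x => f i x - f i p) p \in unitmx.
    by rewrite JE; have [] := regular_hierarchy_comp2 n_gt0 Hf Vp.
  (* The companion identity holds on all of [V]; shrinking to [W] is needed for the joint map to be
     injective. *)
  have [W [Wp WV coordW]] := inverse_function oV Vp Sfp uJ.
  exists W; split=> //; first exact: subset_trans VU.
  split=> // x /WV Vx; rewrite /matrix_in_coordinates JE.
  by have [] := regular_hierarchy_comp2 n_gt0 Hf Vx.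
(* Arbitrary constants cover both uses: [c i = - f i p] for the centred functions, and [c = 0] for
   reducibility, where the coordinates need not be centred. *)
have of_companion f (c : 'I_n -> R) :
    second_companion_coordinates_near U p L (fun i x => f i x + c i) ->
    regular_hierarchy_near U p L f.
  move=> [V [[oV Vp] VU [coordV compV]]]; exists V; split=> //.
  have JE := jacobian_matrix_addcst f c.
  have [Sfc _ _] := coordV.
  apply: comp2_regular_hierarchy => // [i|x Vx|x Vx].
  - have := smooth_on_addcst (- c i) oV ((smooth_joint_mapP _ oV).1 Sfc i).
    by congr (smooth_on V _); apply/funext => x; rewrite addrK.
  - by rewrite -JE; exact: (coordinates_jacobian_unitmx oV coordV).
  - by rewrite -compV // /matrix_in_coordinates JE.
split.
- move=> V f M [oV Vp] VU [Sf Lf] symM; split=> // x Vx.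
  have CL : Ck_on 1 V L by exact: Ck_on_sub VU (L_smooth 1%N).
  exact: (conservation_law_symmetry oV CL symM (Sf 2%N) (Lf x Vx) Vx
    (L_regular x (VU x Vx))).
- move=> f u; split=> [Hf|[Hu _]]; last exact: of_companion Hu.
  by split; [exact: to_companion|move=> i; rewrite /u subrr].
- move=> u v [V [[oV Vp] _ [[Su _ _] _]]] up [W [[oW Wp] _ [[Sv _ _] _]]] vp duv.
  have oVW : open (V `&` W) by exact: openI.
  have uvi i : \forall x \near p, u i x = v i x.
    apply: (@eq_differential_near _ _ (V `&` W)) => //.
    + by apply: (Ck_on_sub (@subIsetl _ V W)); exact: (smooth_joint_mapP _ oV).1.
    + by apply: (Ck_on_sub (@subIsetr _ V W)); exact: (smooth_joint_mapP _ oW).1.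
    + by rewrite up vp.
    + by apply: filterS duv => x; exact.
  exact: filter_forall uvi.
- split=> [[f Hf]|[u Hu]].
    by exists (fun i x => f i x - f i p); exact: to_companion.
  exists u; apply: (of_companion u (fun=> 0)).
  suff -> : (fun i x => u i x + 0) = u by [].
  by apply/funext => i; apply/funext => x; rewrite addr0.
Qed.
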